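(* Suppose $\phi,\psi$ are in $\mathcal C_2$ for some $a$, with equal expectation $\int\phi\,dm=\int\psi\,dm$. Then for any $0<\alpha<1$ and for any sequence $T_{\beta_1},\dots,T_{\beta_n}$, $n>1$, of maps of the Pomeau-Manneville type defined in the context, with $0<\beta_k\le\alpha$ for $k\in[1,n]$, we have $$\int \left|P_{\beta_n}\circ\cdots\circ P_{\beta_1}(\phi)-P_{\beta_n}\circ\cdots\circ P_{\beta_1}(\psi)\right|dm\;\le\; C_\alpha\,(\|\phi\|_1+\|\psi\|_1)\,n^{-\frac1\alpha+1}(\log n)^{\frac1\alpha},$$ where the constant $C_\alpha$ depends only on the map $T_\alpha$. A similar rate of decay holds for $C^1$ observables $\phi$ and $\psi$ on $S^1$ (with $\int\phi\,dm=\int\psi\,dm$); in this case the left-hand side above has the upper bound $$C_\alpha\,\mathcal F\big(\|\phi\|_{C^1}+\|\psi\|_{C^1}\big)\,n^{-\frac1\alpha+1}(\log n)^{\frac1\alpha},$$ where the function $\mathcal F:\mathbb R\to\mathbb R$ is affine.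
   Context: Here $m$ is Lebesgue measure on $[0,1]$, $\|\cdot\|_1$ is the norm of $L^1(m)$, $S^1$ is $[0,1]$ with the endpoints $0$ and $1$ identified, and $\|\cdot\|_{C^1}$ is the usual $C^1$ norm. For $0<\beta<1$, $T_\beta$ is the map $$T_\beta(x)=\begin{cases} x+\dfrac{3^\beta}{2^{1+\beta}}x^{1+\beta}, & 0\le x\le 2/3,\\[2mm] 3x-2, & 2/3\le x\le 1,\end{cases}$$ which is continuous as a map of $S^1$ (the two values $1$ and $0$ at $x=2/3$ are identified). $P_\beta$ denotes the Perron-Frobenius (transfer) operator of $T_\beta$ with respect to $m$: $P_\beta f(x)=\dfrac{f(y_1)}{T_\beta'(y_1)}+\dfrac{f(y_2)}{T_\beta'(y_2)}$, where $y_1\in[0,2/3]$ and $y_2\in[2/3,1]$ are the preimages of $x$ under the first and second branch respectively, and $T_\beta'$ is the derivative of the corresponding branch. For $0<\alpha<1$ let $$\mathcal C_1=\{f\in C^0(]0,1]):\ f\ge0,\ f\text{ decreasing},\ x\mapsto x^{\alpha+1}f(x)\text{ increasing}\},$$ with monotonicity in the non-strict sense, and, for a constant $a>0$, let $$\mathcal C_2=\Big\{f\in\mathcal C_1\cap L^1(m):\ f(x)\le a\,x^{-\alpha}\int_0^1 f\,dm\Big\}.$$ The cone $\mathcal C_2$ is preserved by all the operators $P_\beta$, $0<\beta\le\alpha$, provided $a$ is large enough.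
   Formalization: In the bound for φ, ψ in the cone C_2, the constant C_α is allowed to depend on the cone parameter a as well as on α, since a constant uniform in all a is impossible; the theorem is proved for every a > 0. *)

(* Defs.v *)
From HB Require Import structures.
From mathcomp Require Import all_boot all_order all_algebra.
From mathcomp Require Import all_classical all_reals all_analysis.

Set Implicit Arguments.
Unset Strict Implicit.
Unset Printing Implicit Defensive.

Import Order.TTheory GRing.Theory Num.Theory.
Import numFieldNormedType.Exports.

Local Open Scope classical_set_scope.
Local Open Scope ring_scope.

(* Functions on [0, 1] (or ]0, 1]) are total functions R -> R whose values
   outside that interval are irrelevant: neither the cones, nor the integrals,
   nor transfer b f restricted to [0, 1] depend on them. *)

(* The two branches of T_b: pm_left b on [0, 2/3], pm_right on [2/3, 1].  The
   absolute value does not change the branch on [0, 2/3]; it only makes the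
   two-sided derivative at the endpoint 0 agree with the one-sided one. *)
Definition pm_left (R : realType) (b x : R) : R :=
  x + 3 `^ b / 2 `^ (1 + b) * `|x| `^ (1 + b).

Definition pm_right (R : realType) (x : R) : R := 3 * x - 2.

(* Each branch is a bijection onto [0, 1] (for 0 < b), so for x in [0, 1] the
   set below is a singleton; the default value 0 is not reached. *)
Definition branch_preimage (R : realType) (D : set R) (g : R -> R) (x : R) : R :=
  xget 0 [set y | D y /\ g y = x].

Definition transfer (R : realType) (b : R) (f : R -> R) (x : R) : R :=
  let y1 := branch_preimage `[0, 2 / 3] (pm_left b) x in
  let y2 := branch_preimage `[2 / 3, 1] (@pm_right R) x in
  f y1 / derive1 (pm_left b) y1 + f y2 / derive1 (@pm_right R) y2.

(* P_{b_n} o ... o P_{b_1}, for bs = [:: b_1; ...; b_n]: b_1 acts first. *)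
Definition transfer_seq (R : realType) (bs : seq R) (f : R -> R) : R -> R :=
  foldl (fun g b => transfer b g) f bs.

Definition expectation01 (R : realType) (f : R -> R) : R :=
  (\int[@lebesgue_measure R]_(x in `[0, 1]) f x)%R.

(* Extended-real valued, so that an upper bound on it entails that the
   integral is finite. *)
Definition L1norm (R : realType) (f : R -> R) : \bar R :=
  (\int[@lebesgue_measure R]_(x in `[0%R, 1%R]) `|f x|%:E)%E.

Definition cone1 (R : realType) (alpha : R) (f : R -> R) : Prop :=
  [/\ {within `]0, 1], continuous f},
      {in `]0, 1]%R, forall x, 0 <= f x},
      {in `]0, 1]%R &, {homo f : x y /~ x <= y}} &
      {in `]0, 1]%R &, {homo (fun x => x `^ (alpha + 1) * f x) : x y / x <= y}}].

Definition cone2 (R : realType) (alpha a : R) (f : R -> R) : Prop :=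
  [/\ cone1 alpha f,
      (@lebesgue_measure R).-integrable `[0, 1] (EFin \o f) &
      {in `]0, 1]%R, forall x, f x <= a * x `^ (- alpha) * expectation01 f}].

(* C^1 functions on the circle S^1 = [0, 1]/(0 ~ 1), seen as 1-periodic C^1
   functions on R. *)
Definition C1_circle (R : realType) (f : R -> R) : Prop :=
  [/\ periodic f 1, forall x, derivable f x 1 & continuous (derive1 f)].

Definition C1norm (R : realType) (f : R -> R) : R :=
  sup [set `|f x| | x in `[0, 1]] + sup [set `|derive1 f x| | x in `[0, 1]].

Definition affine_fun (R : realType) (F : R -> R) : Prop :=
  exists p q : R, forall t, F t = p * t + q.

(* n^(1 - 1/alpha) (log n)^(1/alpha) *)
Definition loss_rate (R : realType) (alpha : R) (n : nat) : R :=
  n%:R `^ (- alpha^-1 + 1) * (ln n%:R) `^ alpha^-1.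

(* Main.v *)
(* For densities f in C_1, write P f = L f + R f with the contributions L and R
   of the left and right branch.  Convexity of the power alpha + 1 shows that
   P f - c stays in C_1 for 0 <= c <= 2/9 f(1), so two densities of equal mass
   can be coupled by removing the same constant c from both.

   To bound f(1) from below, follow the mass that L transports without ever
   using the right branch: after n steps it is the mass of an interval ]0, z]
   with z <= (n alpha / 4)^(-1/alpha), hence small because f <= A x^(-alpha).
   All other mass has passed through R, as a multiple of a constant, and
   P_n ... P_1 1 is bounded below uniformly.  So after n steps f(1) is at least
   a constant times the mass of f on ]z, 1].

   If the uncoupled mass is q^j M, a block of length of order q^(-j/p), with
   p = 1/alpha - 1, multiplies it by q < 1.  These lengths grow geometrically,
   so the mass left after n steps is O(n^(-p)). *)
Require Import Defs.
From HB Require Import structures.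
From mathcomp Require Import all_boot all_order all_algebra.
From mathcomp Require Import all_classical all_reals all_analysis.
From mathcomp Require Import measurable_realfun.
From mathcomp Require Import ring lra.
Import Order.TTheory GRing.Theory Num.Theory.
Import numFieldNormedType.Exports.
Local Open Scope classical_set_scope.
Local Open Scope ring_scope.
Set Implicit Arguments.
Unset Strict Implicit.
Unset Printing Implicit Defensive.

(** * Powers *)

(** The cone inequalities alone bound f(1)/m below only by a power of m/M, where M is the initial
    and m the current mass. Removing a constant at every step on that basis would give the exponent
    (1 - alpha)/(1 + alpha) in place of (1 - alpha)/alpha. Waiting until half of the mass has used
    the right branch gives f(1) >= const m instead, hence a fixed factor q per removal. The bound f
    <= K M x^(-alpha) keeps the initial mass M: a removal lowers the mass of f but not its
    singularity at 0, so a bound by a fixed multiple of m x^(-alpha) need not survive it. With M in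
    the bound, the mass trapped on the left for N steps is of order at most M N^(-p); it is below
    m/2 once N is of order (m/M)^(-1/p), which fixes the length of the blocks. The constants are
    uniform over the sequence because each estimate on T_b reduces to one with exponent alpha:
    (3y/2)^b >= y^alpha for b <= alpha and 0 < y <= 2/3. *)

Lemma powR_continuous (R : realType) (p x : R) : 0 < x ->
  {for x, continuous (@powR R ^~ p)}.
Proof.
move=> x0; apply: differentiable_continuous; apply/derivable1_diffP.
by have [] := is_derive1_powR p x0.
Qed.

(** Weighted AM-GM for x and 1, whose mean is [a]: adding ln z <= z - 1 at z = x/a with weight t and
    at z = 1/a with weight 1 - t gives t ln x - ln a <= 0. *)
Lemma powR_bernoulli_le (R : realType) (t x : R) :
  0 <= t <= 1 -> 0 < x -> x `^ t <= 1 + t * (x - 1).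
Proof.
move=> /andP[t0 t1] x0.
set a := 1 + t * (x - 1).
have a0 : 0 < a.
  rewrite /a; have [->|tn0] := eqVneq t 1; first by rewrite mul1r; lra.
  rewrite (_ : 1 + _ = (1 - t) + t * x); last by ring.
  rewrite ltr_wpDr//; first by rewrite mulr_ge0// ltW.
  by rewrite subr_gt0 lt_neqAle tn0.
rewrite /powR gt_eqF// -[leRHS]lnK ?posrE// ler_expR.
have ln_le (y : R) : 0 < y -> ln y <= y - 1.
  by move=> y0; rewrite -[in leLHS](subrKC 1 y) le_ln1Dx// ltrBrDl subrr.
have := ln_le (x / a) (divr_gt0 x0 a0).
have := ln_le a^-1; rewrite invr_gt0 => /(_ a0).
rewrite ln_div ?posrE// lnV ?posrE// => l1 l2.
rewrite -subr_le0.
rewrite (_ : _ - _ = t * (ln x - ln a) + (1 - t) * - ln a); last by ring.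
have -> : 0 = t * (x / a - 1) + (1 - t) * (a^-1 - 1).
  rewrite (_ : _ + _ = (1 + t * (x - 1)) * a^-1 - 1); last by ring.
  by rewrite -/a divff ?subrr// gt_eqF.
by apply: lerD; apply: ler_wpM2l; rewrite // subr_ge0.
Qed.

Lemma powR_bernoulli_ge (R : realType) (s w : R) :
  1 <= s -> 0 <= w -> 1 + s * w <= (1 + w) `^ s.
Proof.
move=> s1 w0; have s0 : 0 < s by exact: lt_le_trans s1.
have x0 : 0 < 1 + s * w by rewrite ltr_wpDr// mulr_ge0// ltW.
have := @powR_bernoulli_le _ s^-1 (1 + s * w).
rewrite invr_ge0 ltW//= invf_le1// s1 => /(_ isT x0).
rewrite (_ : 1 + s^-1 * _ = 1 + w); last by field; rewrite gt_eqF.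
move=> /(ge0_ler_powR (ltW s0)).
rewrite !nnegrE powR_ge0 addr_ge0// => /(_ isT isT).
by rewrite -powRrM mulVf ?gt_eqF// powRr1// ltW.
Qed.

Lemma powR_convex1 (R : realType) (s t w : R) :
  1 <= s -> 0 <= t <= 1 -> 0 <= w ->
  (1 + t * w) `^ s - 1 <= t * ((1 + w) `^ s - 1).
Proof.
move=> s1 /andP[t0 t1] w0.
have t01 : 0 <= 1 - t <= 1 by apply/andP; split; lra.
have /andP[h0 h1] := t01.
have : ((1 - t) * 1 + (1 - (1 - t)) * (1 + w)) `^ s <=
    (1 - t) * 1 `^ s + (1 - (1 - t)) * (1 + w) `^ s.
  by apply: (@convex_powR R s s1 (Itv01 h0 h1) 1 (1 + w));
    rewrite !inE/= !in_itv/= !andbT ?ler01 ?addr_ge0.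
rewrite powR1 (_ : _ * 1 + _ * (1 + w) = 1 + t * w); last by ring.
by move=> h; lra.
Qed.

(** With u = [pm_u b y], this ratio is the factor between y^(a+1) f(y) and x^(a+1) (L f)(x), where y
    is the left preimage of x; its growth in u gives the last cone condition for L f. The sign of
    its derivative in u is that of (a - b) + a (1 + b) u. *)
Lemma powR_ratio_mono (R : realType) (a b u v : R) :
  0 <= b <= a -> 0 <= u <= v ->
  (1 + u) `^ (a + 1) / (1 + (1 + b) * u) <=
  (1 + v) `^ (a + 1) / (1 + (1 + b) * v).
Proof.
move=> /andP[b0 ba] /andP[u0 uv].
have u1 : 0 < 1 + u by lra.
have bu : 0 < 1 + (1 + b) * u by rewrite ltr_wpDr// mulr_ge0//; lra.
have bv : 0 < 1 + (1 + b) * v by rewrite ltr_wpDr// mulr_ge0//; lra.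
rewrite ler_pdivrMr// mulrAC ler_pdivlMr//.
set w := (v - u) / (1 + u).
have w0 : 0 <= w by rewrite divr_ge0//; lra.
have -> : 1 + v = (1 + u) * (1 + w) by rewrite /w; field; rewrite gt_eqF.
rewrite powRM ?addr_ge0// -mulrA ler_wpM2l ?powR_ge0//.
have a1 : 1 <= a + 1 by lra.
apply: (@le_trans _ _ ((1 + (a + 1) * w) * (1 + (1 + b) * u))); last first.
  by rewrite ler_wpM2r ?powR_bernoulli_ge// ltW.
have vE : v = u + w * (1 + u) by rewrite /w divfK ?gt_eqF//; ring.
rewrite vE -subr_ge0.
rewrite (_ : _ - _ = w * ((a - b) + (a + 1) * (1 + b) * u - (1 + b) * u)); last by ring.
have : 0 <= a * ((1 + b) * u) by rewrite !mulr_ge0//; lra.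
by move=> ?; rewrite mulr_ge0//; lra.
Qed.

(** * The left branch and its inverse *)

(* The relative displacement: [pm_left b y = y * (1 + pm_u b y)] for 0 <= y. *)
Definition pm_u (R : realType) (b y : R) : R := 2^-1 * (3 / 2 * y) `^ b.

Definition pm_leftD (R : realType) (b y : R) : R := 1 + (1 + b) * pm_u b y.

(** Inverse of the left formula on all of ]0, +oo[, which it maps bijectively onto itself; this
    makes continuity at the point 1 two-sided. *)
Definition pm_inv (R : realType) (b x : R) : R :=
  xget 0 [set y | 0 < y /\ pm_left b y = x].

Section LeftBranch.
Context {R : realType}.
Implicit Types b x y : R.

Lemma pm_u_ge0 b y : 0 <= pm_u b y.
Proof. by rewrite mulr_ge0// powR_ge0. Qed.

Lemma pm_u_homo b x y : 0 < b -> 0 <= x -> x <= y -> pm_u b x <= pm_u b y.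
Proof.
move=> b0 x0 xy; rewrite ler_wpM2l//.
by apply: ge0_ler_powR; rewrite ?nnegrE ?(ltW b0)//; lra.
Qed.

Lemma pm_u_le_half b y : 0 < b -> 0 <= y <= 2 / 3 -> pm_u b y <= 2^-1.
Proof.
move=> b0 /andP[y0 y1].
rewrite (le_trans (pm_u_homo b0 y0 y1))// /pm_u.
by rewrite (_ : 3 / 2 * (2 / 3) = 1) ?powR1 ?mulr1//; field.
Qed.

(** Source of the uniformity in b: as 3y/2 <= 1, the displacement from 0 is smallest for the largest
    parameter. *)
Lemma pm_u_ge b a y : 0 < b <= a -> 0 < y <= 2 / 3 -> y `^ a <= 2 * pm_u b y.
Proof.
move=> /andP[b0 ba] /andP[y0 y1].
rewrite /pm_u mulrA divff ?pnatr_eq0// mul1r.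
apply: (@le_trans _ _ (y `^ b)).
  by apply: ger_powR => //; rewrite y0/=; lra.
by apply: ge0_ler_powR; rewrite ?nnegrE ?(ltW b0)//; lra.
Qed.

Lemma pm_leftE b y : 0 < b -> 0 <= y -> pm_left b y = y * (1 + pm_u b y).
Proof.
move=> b0 y0; rewrite /pm_left /pm_u ger0_norm//.
have h1 (z : R) : 0 <= z -> z `^ (1 + b) = z * z `^ b.
  move=> z0; rewrite powRD; first by rewrite powRr1.
  by apply/implyP => /eqP; lra.
rewrite !h1// (@powRM _ (3 / 2) y)// (@powRM _ 3)//.
have -> : 2^-1 `^ b = (2 `^ b)^-1 :> R.
  by rewrite -(@powR_inv1 _ 2)// -powRrM mulN1r powRN.
by field; rewrite gt_eqF// powR_gt0.
Qed.

Lemma pm_leftD_ge1 b y : 0 < b -> 1 <= pm_leftD b y.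
Proof.
by move=> b0; rewrite lerDl mulr_ge0 ?pm_u_ge0// addr_ge0// ltW.
Qed.

Lemma is_derive_pm_left b y : 0 < b -> 0 < y ->
  is_derive y (1 : R) (pm_left b) (pm_leftD b y).
Proof.
move=> b0 y0.
pose g (z : R) : R := z + 3 `^ b / 2 `^ (1 + b) * z `^ (1 + b).
have : is_derive y (1 : R) g (1 + 3 `^ b / 2 `^ (1 + b) * ((1 + b) * y `^ (1 + b - 1))).
  apply: is_deriveD => /=.
  have := @is_deriveZ _ _ _ (fun z => z `^ (1 + b)) (3 `^ b / 2 `^ (1 + b)) y 1 _ (is_derive1_powR (1 + b) y0).
  by [].
have -> : 1 + 3 `^ b / 2 `^ (1 + b) * ((1 + b) * y `^ (1 + b - 1)) = pm_leftD b y.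
  have := pm_leftE b0 (ltW y0); rewrite /pm_left ger0_norm ?(ltW y0)//.
  have -> : y `^ (1 + b) = y * y `^ (1 + b - 1).
    by rewrite -mulr_powRB1 ?ltW//; lra.
  move=> h; have {h} : 3 `^ b / 2 `^ (1 + b) * y `^ (1 + b - 1) = pm_u b y.
    apply: (mulfI (lt0r_neq0 y0)); apply: (addrI y).
    by rewrite mulrCA h; ring.
  by rewrite /pm_leftD => <-; ring.
apply: near_eq_is_derive.
near=> z; rewrite /pm_left /g ger0_norm//.
by near: z; apply: filterS (lt_nbhsr y0) => z; exact: ltW.
Unshelve. end_near. Qed.

Lemma derive1_pm_left b y : 0 < b -> 0 < y ->
  derive1 (pm_left b) y = pm_leftD b y.
Proof.
by move=> b0 y0; have h := is_derive_pm_left b0 y0; rewrite derive1E derive_val.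
Qed.

Lemma pm_left_continuous b x y : 0 < b -> 0 < x ->
  {within `[x, y], continuous (pm_left b)}.
Proof.
move=> b0 x0; apply: derivable_within_continuous => z.
rewrite in_itv/= => /andP[xz _].
by have [] := is_derive_pm_left b0 (lt_le_trans x0 xz).
Qed.

Lemma pm_left_lt b x y : 0 < b -> 0 <= x -> x < y -> pm_left b x < pm_left b y.
Proof.
move=> b0 x0 xy; have y0 := le_lt_trans x0 xy; rewrite !pm_leftE ?(ltW y0)//.
apply: (@lt_le_trans _ _ (y * (1 + pm_u b x))).
  by rewrite ltr_pM2r// ltr_pwDl// pm_u_ge0.
by rewrite ler_pM2l// lerD2l pm_u_homo// ltW.
Qed.

Lemma pm_left_le b x y : 0 < b -> 0 <= x -> x <= y -> pm_left b x <= pm_left b y.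
Proof.
move=> b0 x0; rewrite le_eqVlt => /predU1P[->//|xy].
by rewrite ltW// pm_left_lt.
Qed.

Lemma pm_left_inj b x y : 0 < b -> 0 <= x -> 0 <= y ->
  pm_left b x = pm_left b y -> x = y.
Proof.
move=> b0 x0 y0 e; have [h|h|//] := ltgtP x y.
- by have := pm_left_lt b0 x0 h; rewrite e ltxx.
- by have := pm_left_lt b0 y0 h; rewrite e ltxx.
Qed.

Lemma pm_left23 b : 0 < b -> pm_left b (2 / 3) = 1.
Proof.
move=> b0; rewrite pm_leftE// /pm_u (_ : 3 / 2 * (2 / 3) = 1); last by field.
by rewrite powR1; field.
Qed.

Lemma pm_invP b x : 0 < b -> 0 < x ->
  0 < pm_inv b x /\ pm_left b (pm_inv b x) = x.
Proof.
move=> b0 x0; rewrite /pm_inv; case: xgetP => [y -> //|/(_ _) h]; exfalso.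
(* Lower end of the bracket for the intermediate value theorem: e <= x, so [pm_left b e] = e (1 +
   [pm_u b e]) <= e (1 + [pm_u b x]) = x. *)
set e := x / (1 + pm_u b x).
have u0 : 0 < 1 + pm_u b x by rewrite ltr_pwDl// pm_u_ge0.
have e0 : 0 < e by rewrite divr_gt0.
have ex : e <= x by rewrite ler_pdivrMr// ler_peMr ?(ltW x0)// lerDl pm_u_ge0.
have [||c] := @IVT _ (pm_left b) e x x ex.
- exact: pm_left_continuous.
- rewrite ge_min le_max; apply/andP; split; apply/orP; [left|right].
    rewrite pm_leftE ?(ltW e0)// -[leRHS](divfK (lt0r_neq0 u0)).
    by rewrite ler_wpM2l ?(ltW e0)// lerD2l pm_u_homo// ltW.
  by rewrite pm_leftE ?(ltW x0)// ler_peMr ?(ltW x0)// lerDl pm_u_ge0.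
- by rewrite in_itv/= => /andP[ec _] cx; apply: (h c); split => //; exact: lt_le_trans ec.
Qed.

Lemma pm_inv_gt0 b x : 0 < b -> 0 < x -> 0 < pm_inv b x.
Proof. by move=> b0 x0; case: (pm_invP b0 x0). Qed.

Lemma pm_invK b x : 0 < b -> 0 < x -> pm_left b (pm_inv b x) = x.
Proof. by move=> b0 x0; case: (pm_invP b0 x0). Qed.

Lemma pm_left_gt0 b y : 0 < b -> 0 < y -> 0 < pm_left b y.
Proof.
by move=> b0 y0; rewrite pm_leftE ?(ltW y0)// mulr_gt0// ltr_pwDl// pm_u_ge0.
Qed.

Lemma pm_leftK b y : 0 < b -> 0 < y -> pm_inv b (pm_left b y) = y.
Proof.
move=> b0 y0; have ly0 := pm_left_gt0 b0 y0.
by apply: (@pm_left_inj b); rewrite ?ltW ?pm_inv_gt0 ?pm_invK.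
Qed.

Lemma pm_inv_lt b x y : 0 < b -> 0 < x -> x < y -> pm_inv b x < pm_inv b y.
Proof.
move=> b0 x0 xy; have y0 := lt_trans x0 xy; rewrite ltNge; apply/negP => h.
move: xy; rewrite -(pm_invK b0 x0) -(pm_invK b0 y0) ltNge => /negP; apply.
by apply: pm_left_le => //; rewrite ltW// pm_inv_gt0.
Qed.

Lemma pm_inv_le b x y : 0 < b -> 0 < x -> x <= y -> pm_inv b x <= pm_inv b y.
Proof.
move=> b0 x0; rewrite le_eqVlt => /predU1P[->//|xy].
by rewrite ltW// pm_inv_lt.
Qed.

Lemma pm_inv1 b : 0 < b -> pm_inv b 1 = 2 / 3.
Proof.
move=> b0; have := @pm_leftK b (2 / 3) b0.
by rewrite pm_left23 ?divr_gt0// => ->.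
Qed.

Lemma pm_inv_le23 b x : 0 < b -> 0 < x <= 1 -> pm_inv b x <= 2 / 3.
Proof. by move=> b0 /andP[x0 x1]; rewrite -(pm_inv1 b0) pm_inv_le. Qed.

Lemma pm_inv_continuous b x : 0 < b -> 0 < x -> {for x, continuous (pm_inv b)}.
Proof.
move=> b0 x0; have y0 := pm_inv_gt0 b0 x0; set y := pm_inv b x in y0.
have y2 : 0 < y / 2 by rewrite divr_gt0.
have yy : y / 2 < 2 * y by lra.
have := @segment_can_le_continuous _ (y / 2) (2 * y) (pm_left b) (pm_inv b) (ltW yy).
move=> /(_ (pm_left_continuous b0 y2)).
have K : {in `[y / 2, 2 * y], cancel (pm_left b) (pm_inv b)}.
  by move=> z; rewrite in_itv/= => /andP[yz _]; rewrite pm_leftK//; lra.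
move=> /(_ K) /continuous_within_itvP [|+ _ _].
  by rewrite pm_left_lt// ltW.
apply; rewrite in_itv/= -(pm_invK b0 x0) -/y !pm_left_lt//; lra.
Qed.

Lemma pm_u_continuous b x : 0 < x -> {for x, continuous (pm_u b)}.
Proof.
move=> x0; rewrite /pm_u.
apply: cvgM; first exact: cvg_cst.
apply: (@continuous_comp _ _ _ (fun x => 3 / 2 * x) (@powR R ^~ b)).
  by apply: cvgM; [exact: cvg_cst|exact: cvg_id].
by apply: powR_continuous; rewrite mulr_gt0.
Qed.

Lemma pm_leftD_continuous b x : 0 < x -> {for x, continuous (pm_leftD b)}.
Proof.
move=> x0; rewrite /pm_leftD.
apply: cvgD; first exact: cvg_cst.
by apply: cvgM; [exact: cvg_cst|exact: pm_u_continuous].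
Qed.

Lemma branch_preimage_left b x : 0 < b -> 0 < x <= 1 ->
  branch_preimage `[0, 2 / 3] (pm_left b) x = pm_inv b x.
Proof.
move=> b0 /[dup] x01 /andP[x0 _]; rewrite /branch_preimage; case: xgetP => [y _ []|/(_ (pm_inv b x))].
  rewrite /= in_itv/= => /andP[y0 _] e.
  by apply: (@pm_left_inj b) => //; rewrite ?pm_invK// ltW// pm_inv_gt0.
move=> h; exfalso; apply: h; split; last by rewrite pm_invK.
by rewrite /= in_itv/= ltW ?pm_inv_gt0// pm_inv_le23.
Qed.

Lemma branch_preimage_right x : 0 < x <= 1 ->
  branch_preimage `[2 / 3, 1] (@pm_right R) x = (x + 2) / 3.
Proof.
move=> /andP[x0 x1]; rewrite /branch_preimage; case: xgetP => [y _ []|/(_ ((x + 2) / 3))].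
  by rewrite /pm_right => _ <-; field.
move=> h; exfalso; apply: h; split; last by rewrite /pm_right; field.
by rewrite /= in_itv/=; apply/andP; split; lra.
Qed.

Lemma derive1_pm_right x : derive1 (@pm_right R) x = 3.
Proof.
rewrite derive1E /pm_right deriveB// deriveM// derive_id !derive_cst.
by rewrite scaler0 addr0 subr0 /GRing.scale/= mulr1.
Qed.

End LeftBranch.

(** * The cone *)

Definition left_op {R : realType} (b : R) (f : R -> R) (x : R) : R :=
  f (pm_inv b x) / pm_leftD b (pm_inv b x).

Definition right_op {R : realType} (f : R -> R) (x : R) : R := f ((x + 2) / 3) / 3.

Definition pm_op {R : realType} (b : R) (f : R -> R) (x : R) : R :=
  left_op b f x + right_op f x.

(* Unlike in [cone1], continuity is required on all of ]0, +oo[: this spares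
   the one-sided limits at 1, and [pm_op] preserves it. *)
Definition cone {R : realType} (a : R) (f : R -> R) : Prop :=
  [/\ forall x : R, 0 < x -> {for x, continuous f},
      forall x : R, 0 < x <= 1 -> 0 <= f x,
      forall x y : R, 0 < x -> x <= y <= 1 -> f y <= f x &
      forall x y : R, 0 < x -> x <= y <= 1 -> x `^ (a + 1) * f x <= y `^ (a + 1) * f y].

Section Cone.
Context {R : realType}.
Implicit Types a b c x y q A M : R.
Implicit Types f g : R -> R.

Lemma left_op_continuous b f x : 0 < b -> 0 < x ->
  (forall y, 0 < y -> {for y, continuous f}) -> {for x, continuous (left_op b f)}.
Proof.
move=> b0 x0 cf; rewrite /left_op; apply: cvgM.
  apply: (@continuous_comp _ _ _ (pm_inv b) f); first exact: pm_inv_continuous.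
  by apply: cf; exact: pm_inv_gt0.
apply: cvgV; first by rewrite gt_eqF// (lt_le_trans ltr01 (pm_leftD_ge1 _ b0)).
apply: (@continuous_comp _ _ _ (pm_inv b) (pm_leftD b)); first exact: pm_inv_continuous.
by apply: pm_leftD_continuous; exact: pm_inv_gt0.
Qed.

Lemma coneD a f g : cone a f -> cone a g -> cone a (fun x => f x + g x).
Proof.
move=> [f1 f2 f3 f4] [g1 g2 g3 g4]; split => [x x0|x x0|x y x0 xy|x y x0 xy].
- by apply: cvgD; [exact: f1|exact: g1].
- by rewrite addr_ge0 ?f2 ?g2.
- by rewrite lerD ?f3 ?g3.
- by rewrite !mulrDr lerD ?f4 ?g4.
Qed.

Lemma cone_cst a c : 0 <= a -> 0 <= c -> cone a (fun=> c).
Proof.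
move=> a0 c0; split => // [x x0|x y x0 /andP[xy _]]; first exact: cvg_cst.
by rewrite ler_wpM2r//; apply: ge0_ler_powR; rewrite ?nnegrE; lra.
Qed.

Lemma cone_left_op a b f : 0 < b <= a -> cone a f -> cone a (left_op b f).
Proof.
move=> /andP[b0 ba] [f1 f2 f3 f4].
have D0 y : 0 < pm_leftD b y by exact: lt_le_trans (pm_leftD_ge1 y b0).
have inv01 x : 0 < x <= 1 -> 0 < pm_inv b x <= 1.
  move=> x01; have /andP[x0 _] := x01; rewrite pm_inv_gt0//=.
  by rewrite (le_trans (pm_inv_le23 b0 x01))//; lra.
have invle x y : 0 < x -> x <= y <= 1 -> pm_inv b x <= pm_inv b y <= 1.
  move=> x0 /andP[xy y1]; rewrite pm_inv_le//=.
  by have /(_ _)/andP[|//] := inv01 y; rewrite y1 (lt_le_trans x0 xy).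
split => [x x0|x x0|x y x0 xy|x y x0 xy].
- exact: left_op_continuous.
- by rewrite divr_ge0 ?f2 ?inv01// ltW.
- have h := invle _ _ x0 xy; have /andP[h1 h2] := h.
  have ix0 := pm_inv_gt0 b0 x0; have iy0 := lt_le_trans ix0 h1.
  apply: ler_pM => //.
  + by rewrite f2// iy0.
  + by rewrite invr_ge0 ltW.
  + exact: f3.
  + rewrite lef_pV2 ?posrE// lerD2l ler_wpM2l//; first by rewrite addr_ge0// ltW.
    by apply: pm_u_homo => //; rewrite ltW.
- have h := invle _ _ x0 xy; have /andP[h1 h2] := h.
  have ix0 := pm_inv_gt0 b0 x0; have iy0 := lt_le_trans ix0 h1.
  have y0 : 0 < y by have /andP[/(lt_le_trans x0)] := xy.
  have E z : 0 < z -> z `^ (a + 1) * left_op b f z = (pm_inv b z `^ (a + 1) * f (pm_inv b z))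
       * ((1 + pm_u b (pm_inv b z)) `^ (a + 1) / (1 + (1 + b) * pm_u b (pm_inv b z))).
    move=> z0; have iz0 := pm_inv_gt0 b0 z0.
    rewrite -{1}(pm_invK b0 z0) pm_leftE ?(ltW iz0)// powRM ?(ltW iz0)//.
      by rewrite /left_op /pm_leftD; ring.
    by rewrite addr_ge0// pm_u_ge0.
  rewrite !E//; apply: ler_pM.
  + by rewrite mulr_ge0 ?powR_ge0// f2// ix0/= (le_trans h1).
  + by rewrite divr_ge0 ?powR_ge0// -/(pm_leftD _ _) ltW.
  + exact: f4.
  + by apply: powR_ratio_mono; rewrite ?(ltW b0)// pm_u_ge0/= pm_u_homo// ltW.
Qed.

(* By convexity the relative growth of the (a+1)-st power between (x+2)/3 and
   (y+2)/3 is at most a third of the one between x and y; this leaves room for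
   the constant [c]. *)
Lemma cone_right_op_sub a f c : 0 <= a -> cone a f -> 0 <= c <= 2 / 9 * f 1 ->
  cone a (fun x => right_op f x - c).
Proof.
move=> a0 [f1 f2 f3 f4] /andP[c0 cf].
have r01 x : 0 < x <= 1 -> 0 < (x + 2) / 3 <= 1 by move=> ?; apply/andP; split; lra.
have rle x y : 0 < x -> x <= y <= 1 -> (x + 2) / 3 <= (y + 2) / 3 <= 1.
  by move=> ? ?; apply/andP; split; lra.
have f1le x : 0 < x <= 1 -> f 1 <= f ((x + 2) / 3).
  by move=> /r01/andP[? ?]; apply: f3; rewrite // lexx andbT.
split => [x x0|x x0|x y x0 xy|x y x0 xy].
- apply: cvgB; last exact: cvg_cst.
  apply: cvgM; last exact: cvg_cst.
  apply: (@continuous_comp _ _ _ (fun x => (x + 2) / 3) f).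
    by apply: cvgM; [apply: cvgD; [exact: cvg_id|exact: cvg_cst]|exact: cvg_cst].
  by apply: f1; lra.
- have := f2 1; rewrite ltr01 lexx => /(_ isT) f10.
  by have := f1le x x0; rewrite /right_op; lra.
- have := f3 ((x + 2) / 3) ((y + 2) / 3); rewrite /right_op rle// => h.
  by rewrite lerB// ler_wpM2r// h//; lra.
- have /andP[xy1 y1] := xy; have y0 := lt_le_trans x0 xy1.
  set F := f ((y + 2) / 3).
  set w := (y - x) / x; set t := x / (x + 2).
  have w0 : 0 <= w by rewrite divr_ge0 ?(ltW x0)//; lra.
  have t0 : 0 <= t by rewrite divr_ge0//; lra.
  have t13 : t <= 3^-1 by rewrite ler_pdivrMr//; lra.
  have xn0 : x != 0 by rewrite gt_eqF.
  have x2n0 : x + 2 != 0 by rewrite gt_eqF//; lra.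
  have ye : y = x * (1 + w) by rewrite /w; field.
  have y2e : (y + 2) / 3 = (x + 2) / 3 * (1 + t * w).
    by rewrite /t /w; field; apply/andP; split.
  have conv := @powR_convex1 _ (a + 1) t w; rewrite lerDr a0 in conv.
  have {}conv : (1 + t * w) `^ (a + 1) - 1 <= t * ((1 + w) `^ (a + 1) - 1).
    by apply: conv => //; rewrite t0/=; lra.
  have tw0 : 0 <= t * w by rewrite mulr_ge0.
  have ge1 (z : R) : 0 <= z -> 1 <= (1 + z) `^ (a + 1).
    move=> z0; apply: (le_trans _ (powR_bernoulli_ge _ z0)); last by lra.
    by rewrite lerDl mulr_ge0//; lra.
  have r1 := ge1 _ w0; have s1 := ge1 _ tw0.
  set r := (1 + w) `^ (a + 1) in conv r1 *.
  set s := (1 + t * w) `^ (a + 1) in conv s1 *.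
  have fx : f ((x + 2) / 3) <= s * F.
    have := f4 ((x + 2) / 3) ((y + 2) / 3); rewrite rle// divr_gt0; [|by lra..].
    move=> /(_ isT isT); rewrite {1}y2e (@powRM _ ((x + 2) / 3)); [|lra..].
    by rewrite -mulrA ler_pM2l//; apply: powR_gt0; lra.
  have Fq : f 1 <= F by apply: f1le; rewrite y0.
  have f10 : 0 <= f 1 by apply: f2; rewrite ltr01 lexx.
  rewrite ye powRM ?(ltW x0)//; last by lra.
  rewrite -mulrA ler_wpM2l ?powR_ge0// -ye -/r.
  have -> : right_op f y = F / 3 by [].
  rewrite /right_op.
  (* Origin of 2/9: it remains to see (r - 1) c <= (r - s) F / 3, and here r - s >= 2/3 (r - 1) and
     F >= f(1). *)
  have h1 : t * (r - 1) <= 3^-1 * (r - 1) by rewrite ler_wpM2r//; lra.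
  have h2 : 2 / 3 * (r - 1) * f 1 <= (r - s) * F.
    apply: (@le_trans _ _ (2 / 3 * (r - 1) * F)).
      by rewrite ler_wpM2l// mulr_ge0//; lra.
    by rewrite ler_wpM2r//; lra.
  have h3 : (r - 1) * c <= (r - 1) * (2 / 9 * f 1) by rewrite ler_wpM2l//; lra.
  by nra.
Qed.

Lemma cone_pm_op_sub a b f c : 0 < b <= a -> cone a f -> 0 <= c <= 2 / 9 * f 1 ->
  cone a (fun x => pm_op b f x - c).
Proof.
move=> /[dup] ba /andP[b0 ba1] cf cc; have a0 : 0 <= a by lra.
have := coneD (cone_left_op ba cf) (cone_right_op_sub a0 cf cc).
by congr (cone a _); apply/funext => x; rewrite /pm_op addrA.
Qed.

Lemma cone_right_op a f : 0 <= a -> cone a f -> cone a (right_op f).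
Proof.
move=> a0 cf; have := @cone_right_op_sub a f 0 a0 cf.
have : 0 <= f 1 by have [_ f0 _ _] := cf; apply: f0; rewrite ltr01 lexx.
move=> f10 /(_ _)/wrap[].
  by rewrite lexx mulr_ge0.
by congr (cone a _); apply/funext => x; rewrite subr0.
Qed.

Lemma cone_pm_op a b f : 0 < b <= a -> cone a f -> cone a (pm_op b f).
Proof.
move=> /[dup] ba /andP[b0 ba1] cf.
by apply: coneD; [exact: cone_left_op|apply: cone_right_op => //; lra].
Qed.

(** What L loses pays for what R adds. With x = y (1 + u), Bernoulli's inequality gives L f(x) <= A
    x^(-a) (1 - (1 - a) u / 2), and x^(-a) u >= 1/3, so the loss is at least A (1 - a) / 6 >= M / 2.
    The right branch adds at most f(2/3) / 3 <= M / 2. *)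
Lemma pm_op_bound a b f A M : 0 < b <= a -> a < 1 -> cone a f ->
  f (2 / 3) <= 3 / 2 * M -> 3 * M <= A * (1 - a) -> 0 <= A ->
  (forall x, 0 < x <= 1 -> f x <= A * x `^ (- a)) ->
  forall x, 0 < x <= 1 -> pm_op b f x <= A * x `^ (- a).
Proof.
move=> ba a1 [f1 f2 f3 f4] f23 MA A0 fA x x01.
have /andP[b0 ba1] := ba; have a0 : 0 < a by lra.
have /andP[x0 x1] := x01.
set y := pm_inv b x; have y0 : 0 < y by exact: pm_inv_gt0.
have y23 : y <= 2 / 3 by exact: pm_inv_le23.
set u := pm_u b y; have u0 : 0 <= u by exact: pm_u_ge0.
have u12 : u <= 2^-1 by apply: pm_u_le_half => //; rewrite (ltW y0).
have yu : y `^ a <= 2 * u by apply: pm_u_ge => //; rewrite y0.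
have xE : x = y * (1 + u) by rewrite -(pm_invK b0 x0) pm_leftE// ltW.
have u1 : 0 < 1 + u by lra.
have D0 : 0 < 1 + (1 + b) * u by rewrite ltr_pwDl// mulr_ge0//; lra.
have fy : f y <= A * y `^ (- a) by apply: fA; rewrite y0/=; lra.
have fr : f ((x + 2) / 3) <= 3 / 2 * M.
  by apply: le_trans f23; apply: f3; [lra|apply/andP; split; lra].
have y'E : y `^ (- a) = x `^ (- a) * (1 + u) `^ a.
  rewrite xE powRM ?(ltW y0) ?(ltW u1)// -mulrA -powRD; last by rewrite (gt_eqF u1) implybT.
  by rewrite addNr powRr0 mulr1.
have B : (1 + u) `^ a <= 1 + a * u.
  have := @powR_bernoulli_le _ a (1 + u); rewrite addrAC subrr add0r; apply => //.
  by rewrite (ltW a0) ltW.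
have xa0 : 0 < x `^ (- a) by exact: powR_gt0.
have G : 3^-1 <= x `^ (- a) * u.
  have : x `^ a <= 3 * u.
    rewrite xE powRM ?(ltW y0) ?(ltW u1)//.
    have : (1 + u) `^ a <= 3 / 2.
      have : a * u <= 1 * 2^-1 by apply: ler_pM => //; exact: ltW.
      by move: B; lra.
    have := powR_ge0 y a; have := powR_ge0 (1 + u) a; nra.
  by move=> h; rewrite powRN [leRHS]mulrC ler_pdivlMr ?powR_gt0//; lra.
have L : left_op b f x <= A * x `^ (- a) * (1 - (1 - a) * u / 2).
  rewrite /left_op -/y /pm_leftD -/u ler_pdivrMr//.
  apply: (le_trans fy); rewrite y'E mulrA -[leRHS]mulrA ler_wpM2l//.
    by rewrite mulr_ge0// ltW.
  apply: (le_trans B).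
  have h1 : 0 <= (1 - a) * u by rewrite mulr_ge0//; lra.
  have h2 : 0 <= b * u by rewrite mulr_ge0// ltW.
  have h3 : (1 - a) * u * (1 + b) * u <= (1 - a) * u * 1.
    rewrite -[leLHS]mulrA ler_wpM2l//.
    have : (1 + b) * u <= 2 * 2^-1 by apply: ler_pM => //; lra.
    by rewrite divff.
  by lra.
rewrite /pm_op /right_op.
have : A * x `^ (- a) * ((1 - a) * u / 2) = (A * (1 - a)) / 2 * (x `^ (- a) * u) by ring.
have : (A * (1 - a)) / 2 * 3^-1 <= (A * (1 - a)) / 2 * (x `^ (- a) * u).
  by rewrite ler_wpM2l// divr_ge0// mulr_ge0//; lra.
lra.
Qed.

End Cone.

(** * Integrals *)

Section Integrals.
Context {R : realType}.
Local Notation mu := (@lebesgue_measure R).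
Implicit Types a b c x y q A M : R.
Implicit Types f g : R -> R.

Lemma pos_continuous_measurable f (D : set R) : measurable D ->
  D `<=` `]0, +oo[ -> (forall x, 0 < x -> {for x, continuous f}) ->
  measurable_fun D (EFin \o f).
Proof.
move=> mD D0 cf; apply/measurable_EFinP.
apply: (measurable_funS _ D0) => //.
apply: open_continuous_measurable_fun; first exact: interval_open.
by move=> x; rewrite inE/= in_itv/= andbT; exact: cf.
Qed.

Lemma itv_oc0_bigcup y : 0 < y ->
  `]0, y]%classic = \bigcup_n `[y / n.+1%:R, y]%classic.
Proof.
move=> y0; apply/seteqP; split => z /=.
  rewrite in_itv/= => /andP[z0 zy].
  have [n] := ltr_add_invr (divr_gt0 z0 y0).
  rewrite add0r => h; exists n => //=; rewrite in_itv/= zy andbT.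
  by rewrite mulrC -ler_pdivlMr// ltW.
move=> [n _] /=; rewrite !in_itv/= => /andP[h ->]; rewrite andbT.
by apply: lt_le_trans h; rewrite divr_gt0.
Qed.

(** Change of variables. As f may be unbounded at 0, the substitution is made on [e, y] with e > 0,
    and monotone convergence along e = y/(n+1) gives the half-open interval. *)
Lemma integral_left_op b f y : 0 < b -> 0 < y <= 2 / 3 ->
  (forall x, 0 < x -> {for x, continuous f}) ->
  (forall x, 0 < x <= 1 -> 0 <= f x) ->
  (\int[mu]_(x in `]0%R, pm_left b y]) (left_op b f x)%:E =
   \int[mu]_(x in `]0%R, y]) (f x)%:E)%E.
Proof.
move=> b0 /andP[y0 y23] cf f0.
have D0 z : 0 < pm_leftD b z by exact: lt_le_trans (pm_leftD_ge1 z b0).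
have cl x : 0 < x -> {for x, continuous (left_op b f)}.
  by move=> x0; exact: left_op_continuous.
have cD z : 0 < z -> {for z, continuous (derive1 (pm_left b))}.
  move=> z0; have : pm_leftD b t @[t --> z] --> pm_leftD b z by exact: pm_leftD_continuous.
  rewrite -(derive1_pm_left b0 z0); apply: cvg_trans; apply: near_eq_cvg.
  near=> t; rewrite derive1_pm_left//.
  by near: t; exact: lt_nbhsr.
have cF z : 0 < z -> {for z, continuous (pm_left b)}.
  move=> z0; apply: differentiable_continuous; apply/derivable1_diffP.
  by have [] := is_derive_pm_left b0 z0.
have closed e : 0 < e -> e <= y ->
    (\int[mu]_(x in `[pm_left b e, pm_left b y]) (left_op b f x)%:E =
    \int[mu]_(x in `[e, y]) (f x)%:E)%E.
  move=> e0 ey; rewrite integration_by_substitution_increasing//.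
  - apply: eq_integral => x; rewrite inE/= in_itv/= => /andP[ex _].
    have x0 := lt_le_trans e0 ex.
    rewrite !fctE derive1_pm_left// /left_op pm_leftK// divfK//.
    by rewrite gt_eqF.
  - move=> u v; rewrite !in_itv/= => /andP[eu _] _ uv.
    by apply: pm_left_lt => //; rewrite (le_trans (ltW e0)).
  - by move=> z; rewrite in_itv/= => /andP[ez _]; apply: cD; exact: lt_trans ez.
  - by apply/cvg_ex; exists (derive1 (pm_left b) e); apply: cvg_at_right_filter; exact: cD.
  - apply/cvg_ex; exists (derive1 (pm_left b) y); apply: cvg_at_left_filter.
    by apply: cD.
  - split.
    + move=> z; rewrite in_itv/= => /andP[ez _].
      by have [] := is_derive_pm_left b0 (lt_trans e0 ez).
    + by apply: cvg_at_right_filter; exact: cF.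
    + by apply: cvg_at_left_filter; exact: cF.
  - apply: continuous_in_subspaceT => z; rewrite inE/= in_itv/= => /andP[ez _].
    by apply: cl; apply: lt_le_trans ez; exact: pm_left_gt0.
set e := fun n : nat => y / n.+1%:R.
have e0 n : 0 < e n by rewrite divr_gt0.
have eS n m : (n <= m)%N -> e m <= e n.
  by move=> nm; rewrite ler_wpM2l ?(ltW y0)// lef_pV2 ?posrE// ler_nat.
have ey n : e n <= y by rewrite ler_pdivrMr// ler_peMr ?(ltW y0)// ler1n.
have Fe n m : (n <= m)%N -> pm_left b (e m) <= pm_left b (e n).
  by move=> /eS h; apply: pm_left_le => //; exact: ltW.
have lim1 : (\int[mu]_(x in `[e n, y]) (f x)%:E @[n --> \oo] -->
    \int[mu]_(x in `]0%R, y]) (f x)%:E)%E.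
  rewrite itv_oc0_bigcup//; apply: ge0_nondecreasing_set_cvg_integral => //.
  - by move=> n m nm; apply/subsetPset; apply: subset_itvr; rewrite bnd_simp eS.
  - move=> n; apply: pos_continuous_measurable => //.
    by apply: subset_itv; rewrite bnd_simp.
  - move=> n x; rewrite /= in_itv/= => /andP[ex xy]; rewrite lee_fin f0//.
    by rewrite (lt_le_trans (e0 n))//=; lra.
have lim2 : (\int[mu]_(x in `[pm_left b (e n), pm_left b y]) (left_op b f x)%:E @[n --> \oo] -->
    \int[mu]_(x in `]0%R, pm_left b y]) (left_op b f x)%:E)%E.
  have -> : `]0, pm_left b y]%classic = \bigcup_n `[pm_left b (e n), pm_left b y]%classic.
    apply/seteqP; split => z /=.
      rewrite in_itv/= => /andP[z0 zy].
      have iz : `]0, y]%classic (pm_inv b z).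
        rewrite /= in_itv/= pm_inv_gt0//= -(pm_leftK b0 y0).
        exact: pm_inv_le.
      move: iz; rewrite itv_oc0_bigcup// => -[n _] /=; rewrite in_itv/= => /andP[nz _].
      exists n => //=; rewrite in_itv/= zy andbT -(pm_invK b0 z0).
      exact: pm_left_le (ltW (e0 n)) nz.
    move=> [n _] /=; rewrite !in_itv/= => /andP[h ->]; rewrite andbT.
    by apply: lt_le_trans h; rewrite pm_left_gt0.
  apply: ge0_nondecreasing_set_cvg_integral => //.
  - by move=> n m nm; apply/subsetPset; apply: subset_itvr; rewrite bnd_simp Fe.
  - move=> n; apply: pos_continuous_measurable => //.
    by apply: subset_itv; rewrite bnd_simp// pm_left_gt0.
  - move=> n x; rewrite /= in_itv/= => /andP[ex xy]; rewrite lee_fin.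
    have x0 : 0 < x by apply: lt_le_trans ex; exact: pm_left_gt0.
    rewrite divr_ge0 ?(ltW (D0 _))// f0// pm_inv_gt0//=.
    by rewrite (le_trans (pm_inv_le b0 x0 xy))// pm_leftK//; lra.
have : (\int[mu]_(x in `[pm_left b (e n), pm_left b y]) (left_op b f x)%:E @[n --> \oo] -->
    \int[mu]_(x in `]0%R, y]) (f x)%:E)%E.
  by under eq_cvg do rewrite closed//.
exact: cvg_unique.
Unshelve. all: end_near. Qed.

Lemma integral_right_op f : (forall x, 0 < x -> {for x, continuous f}) ->
  (\int[mu]_(x in `]0%R, 1%R]) (right_op f x)%:E =
   \int[mu]_(x in `](2 / 3)%R, 1%R]) (f x)%:E)%E.
Proof.
move=> cf; pose F x : R := (x + 2) / 3.
have dF x : is_derive x (1 : R) F 3^-1.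
  have -> : F = 3^-1 \*: (id + cst 2).
    by apply/funext => z; rewrite /F !fctE /GRing.scale/= mulrC.
  have := is_deriveZ (3^-1 : R) (is_deriveD (is_derive_id x 1) (is_derive_cst (2 : R) x 1)).
  by rewrite addr0 /GRing.scale/= mulr1.
have dF1 : derive1 F = cst 3^-1.
  by apply/funext => x; rewrite derive1E derive_val.
have cF x : {for x, continuous F}.
  apply: differentiable_continuous; apply/derivable1_diffP.
  by have [] := dF x.
have F0 : F 0 = 2 / 3 by rewrite /F add0r.
have F1 : F 1 = 1 by rewrite /F; field.
have cr x : 0 < x + 2 -> {for x, continuous (right_op f)}.
  move=> x0; apply: cvgM; last exact: cvg_cst.
  apply: (@continuous_comp _ _ _ F f); first exact: cF.
  by apply: cf; rewrite /F divr_gt0.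
rewrite integral_itv_obnd_cbnd; last first.
  apply: pos_continuous_measurable => //.
    by apply: subset_itv; rewrite bnd_simp.
  by move=> x x0; apply: cr; lra.
rewrite [RHS]integral_itv_obnd_cbnd; last first.
  apply: pos_continuous_measurable => //.
  by apply: subset_itv; rewrite bnd_simp// divr_ge0.
rewrite -F0 -[in RHS]F1 [RHS]integration_by_substitution_increasing//.
- by apply: eq_integral => x _; rewrite !fctE dF1.
- by move=> u v _ _ uv; rewrite /F; lra.
- by rewrite dF1 => x _; exact: cst_continuous.
- by rewrite dF1; exact: is_cvg_cst.
- by rewrite dF1; exact: is_cvg_cst.
- split.
  + by move=> x _; have [] := dF x.
  + by apply: cvg_at_right_filter; exact: cF.
  + by apply: cvg_at_left_filter; exact: cF.
- rewrite F0 F1; apply: continuous_in_subspaceT => z; rewrite inE/= in_itv/= => /andP[ez _].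
  by apply: cf; apply: lt_le_trans ez; rewrite divr_gt0.
Qed.

End Integrals.

(** * Mass on subintervals and values of the density *)

Section Mass.
Context {R : realType}.
Local Notation mu := (@lebesgue_measure R).
Implicit Types a b c d x y q A M m : R.
Implicit Types f g : R -> R.

Lemma cone_measurable a f (D : set R) : measurable D -> D `<=` `]0, +oo[ ->
  cone a f -> measurable_fun D (EFin \o f).
Proof. by move=> mD D0 [cf _ _ _]; exact: pos_continuous_measurable. Qed.

Lemma integral_oc0_split a f x y : 0 < x <= y -> y <= 1 -> cone a f ->
  (\int[mu]_(t in `]0%R, y]) (f t)%:E =
   \int[mu]_(t in `]0%R, x]) (f t)%:E + \int[mu]_(t in `]x, y]) (f t)%:E)%E.
Proof.
move=> /andP[x0 xy] y1 cf.
have <- : `]0, x]%classic `|` `]x, y]%classic = `]0, y]%classic.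
  by rewrite -itv_bndbnd_setU// bnd_simp// ltW.
rewrite ge0_integral_setU//.
- apply: (cone_measurable _ _ cf) => //; first exact: measurableU.
  move=> z [] /=; rewrite !in_itv/= andbT => /andP[]// xz _.
  exact: lt_trans xz.
- have [_ f0 _ _] := cf.
  move=> z [] /=; rewrite in_itv/= => /andP[? ?]; rewrite lee_fin f0//; lra.
- apply/disj_setPRL => z /=; rewrite !in_itv/= => /andP[xz _].
  by move=> /andP[_]; rewrite leNgt xz.
Qed.

Lemma integral_le_sup a f x y : 0 < x <= y -> y <= 1 -> cone a f ->
  (\int[mu]_(t in `]x, y]) (f t)%:E <= (f x * (y - x))%:E)%E.
Proof.
move=> /andP[x0 xy] y1 cf; have [_ f0 fd _] := cf.
apply: (@le_trans _ _ (\int[mu]_(t in `]x, y]) (cst (f x)%:E) t)%E).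
  apply: ge0_le_integral => //=.
  - by move=> z; rewrite in_itv/= lee_fin => /andP[? ?]; apply: f0; lra.
  - apply: (cone_measurable _ _ cf) => //.
    by apply: subset_itv; rewrite bnd_simp// ltW.
  - move=> z; rewrite in_itv/= lee_fin => /andP[? ?]; apply: fd => //; lra.
rewrite integral_cst//= lebesgue_measure_itv/= lte_fin.
case: ltP => h; first by rewrite -EFinD -EFinM.
by rewrite mule0 lee_fin mulr_ge0 ?subr_ge0// f0//; lra.
Qed.

Lemma integral_left_op_inv b f x : 0 < b -> 0 < x <= 1 ->
  (forall x, 0 < x -> {for x, continuous f}) ->
  (forall x, 0 < x <= 1 -> 0 <= f x) ->
  (\int[mu]_(t in `]0%R, x]) (left_op b f t)%:E =
   \int[mu]_(t in `]0%R, pm_inv b x]) (f t)%:E)%E.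
Proof.
move=> b0 /[dup] x01 /andP[x0 x1] cf f0.
have := @integral_left_op _ b f (pm_inv b x) b0.
by rewrite pm_invK// pm_inv_gt0// pm_inv_le23// => /(_ isT cf f0).
Qed.

Lemma integral_pm_op a b f : 0 < b <= a -> cone a f ->
  (\int[mu]_(t in `]0%R, 1%R]) (pm_op b f t)%:E =
   \int[mu]_(t in `]0%R, 1%R]) (f t)%:E)%E.
Proof.
move=> /[dup] ba /andP[b0 ba1] cf; have [f1 f2 _ _] := cf.
have [r1 r2 _ _] := @cone_right_op _ a f (le_trans (ltW b0) ba1) cf.
have [l1 l2 _ _] := cone_left_op ba cf.
have sub01 : (`]0, 1]%classic : set R) `<=` `]0, +oo[.
  by apply: subset_itv; rewrite bnd_simp.
rewrite /pm_op; under eq_integral do rewrite EFinD.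
rewrite ge0_integralD//=; last 2 first.
- exact: (pos_continuous_measurable _ sub01).
- exact: (pos_continuous_measurable _ sub01).
rewrite integral_left_op_inv// ?ltr01 ?lexx// integral_right_op// pm_inv1//.
rewrite -(@integral_oc0_split a)//; lra.
Qed.

Lemma integral_oc01_cst c :
  (\int[mu]_(t in `]0%R, 1%R]) c%:E = c%:E)%E.
Proof.
transitivity (\int[mu]_(t in `]0%R, 1%R]) (cst c%:E) t)%E => //.
rewrite integral_cst//= lebesgue_measure_itv/= lte_fin ltr01.
by rewrite oppr0 adde0 mule1.
Qed.

Lemma integral_sub_cst f m c : 0 <= c ->
  (forall x, 0 < x -> {for x, continuous f}) ->
  (forall x, 0 < x <= 1 -> 0 <= f x - c) ->
  (\int[mu]_(t in `]0%R, 1%R]) (f t)%:E = m%:E)%E ->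
  (\int[mu]_(t in `]0%R, 1%R]) (f t - c)%:E = (m - c)%:E)%E.
Proof.
move=> c0 cf f0 fm.
have : (\int[mu]_(t in `]0%R, 1%R]) (f t)%:E =
    \int[mu]_(t in `]0%R, 1%R]) (f t - c)%:E + c%:E)%E.
  rewrite -[in RHS](integral_oc01_cst c) -ge0_integralD//=.
  - by apply: eq_integral => t _; rewrite -EFinD subrK.
  - apply: pos_continuous_measurable => //.
      by apply: subset_itv; rewrite bnd_simp.
    by move=> x x0; apply: cvgB; [exact: cf|exact: cvg_cst].
rewrite fm; case: (\int[mu]_(t in _) (f t - c)%:E)%E => [r| |]//= [->].
by rewrite addrK.
Qed.

Lemma integral_powRN_le a y : 0 < a < 1 -> 0 < y ->
  (\int[mu]_(t in `]0%R, y]) (t `^ (- a))%:E <= (y `^ (1 - a) / (1 - a))%:E)%E.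
Proof.
move=> /andP[a0 a1] y0.
have a10 : 0 < 1 - a by rewrite subr_gt0.
have dF x : 0 < x -> is_derive x (1 : R) ((1 - a)^-1 \*: (@powR R ^~ (1 - a))) (x `^ (- a)).
  move=> x0; have := is_deriveZ ((1 - a)^-1 : R) (is_derive1_powR (1 - a) x0).
  have -> : (1 - a)^-1 *: ((1 - a) * x `^ (1 - a - 1)) = x `^ (- a).
    by rewrite /GRing.scale/= mulKf ?gt_eqF//; congr powR; ring.
  by [].
have closed e : 0 < e < y ->
    (\int[mu]_(x in `[e, y]) (x `^ (- a))%:E <= (y `^ (1 - a) / (1 - a))%:E)%E.
  move=> /andP[e0 ey].
  rewrite (@continuous_FTC2 _ _ ((1 - a)^-1 \*: (@powR R ^~ (1 - a)))%R)//.
  - rewrite -EFinB lee_fin/= /GRing.scale/= [leRHS]mulrC lerBlDr lerDl.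
    by rewrite mulr_ge0 ?powR_ge0// invr_ge0 ltW.
  - apply: continuous_in_subspaceT => z; rewrite inE/= in_itv/= => /andP[ez _].
    by apply: powR_continuous; exact: lt_le_trans ez.
  - split.
    + move=> z; rewrite in_itv/= => /andP[ez _].
      by have [] := dF z (lt_trans e0 ez).
    + apply: cvg_at_right_filter; apply: differentiable_continuous.
      by apply/derivable1_diffP; have [] := dF e e0.
    + apply: cvg_at_left_filter; apply: differentiable_continuous.
      by apply/derivable1_diffP; have [] := dF y y0.
  - move=> z; rewrite in_itv/= => /andP[ez _].
    by have h := dF z (lt_trans e0 ez); rewrite derive1E derive_val.
have e0 n : 0 < y / n.+1%:R by rewrite divr_gt0.
have lim : (\int[mu]_(x in `[(y / n.+1%:R)%R, y]) (x `^ (- a))%:E @[n --> \oo] -->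
    \int[mu]_(x in `]0%R, y]) (x `^ (- a))%:E)%E.
  rewrite itv_oc0_bigcup//; apply: ge0_nondecreasing_set_cvg_integral => //.
  - move=> n m nm; apply/subsetPset; apply: subset_itvr; rewrite bnd_simp.
    by rewrite ler_wpM2l ?(ltW y0)// lef_pV2 ?posrE// ler_nat.
  - move=> n; apply: pos_continuous_measurable => //; last by move=> x; exact: powR_continuous.
    by apply: subset_itv; rewrite bnd_simp.
  - by move=> n x _; rewrite lee_fin powR_ge0.
rewrite -(cvg_lim _ lim)//; apply: lime_le; first by apply/cvg_ex; eexists; exact: lim.
near=> n; apply: closed; rewrite e0/= ltr_pdivrMr// ltr_pMr// ltr1n.
by rewrite ltnS; near: n; exact: nbhs_infty_gt.
Unshelve. all: end_near. Qed.

Lemma integral_bound_le a A f y : 0 < a < 1 -> 0 <= A -> 0 < y <= 1 -> cone a f ->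
  (forall x, 0 < x <= 1 -> f x <= A * x `^ (- a)) ->
  (\int[mu]_(t in `]0%R, y]) (f t)%:E <= (A * (y `^ (1 - a) / (1 - a)))%:E)%E.
Proof.
move=> a01 A0 /andP[y0 y1] cf fA; have [_ f0 _ _] := cf.
have sub : `]0, y]%classic `<=` `]0, +oo[.
  by apply: subset_itv; rewrite bnd_simp.
have mp : measurable_fun `]0, y]%classic (EFin \o (@powR R ^~ (- a))).
  by apply: pos_continuous_measurable => // x; exact: powR_continuous.
apply: (@le_trans _ _ (\int[mu]_(t in `]0%R, y]) (A%:E * (t `^ (- a))%:E))%E).
  apply: ge0_le_integral => //=.
  - by move=> z; rewrite in_itv/= lee_fin => /andP[? ?]; apply: f0; lra.
  - exact: (cone_measurable _ sub cf).
  - exact: measurable_funeM.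
  - by move=> z; rewrite in_itv/= -EFinM lee_fin => /andP[? ?]; apply: fA; lra.
rewrite ge0_integralZl//= ?lee_fin//; last by move=> z _; rewrite lee_fin powR_ge0.
by rewrite EFinM lee_wpmul2l ?lee_fin// integral_powRN_le.
Qed.

(** At most half of the mass lies on ]0, d], so the decreasing f satisfies f(d) >= m/2, and the
    growth of x^(a+1) f(x) carries this to 1. The loss of d^(a+1) is harmless for the iterates of
    the density 1, where one d serves all sequences. *)
Lemma cone_at1_ge a A f m d : 0 < a < 1 -> 0 <= A -> cone a f ->
  (forall x, 0 < x <= 1 -> f x <= A * x `^ (- a)) ->
  (\int[mu]_(t in `]0%R, 1%R]) (f t)%:E = m%:E)%E ->
  0 < d <= 1 -> A * (d `^ (1 - a) / (1 - a)) <= m / 2 ->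
  d `^ (a + 1) * (m / 2) <= f 1.
Proof.
move=> a01 A0 cf fA fm d01 dm; have [_ f0 _ fi] := cf.
have /andP[d0 d1] := d01.
have fd0 : 0 <= f d by exact: f0.
have mfd : m / 2 <= f d.
  have := @integral_oc0_split a f d 1 d01 (lexx 1) cf; rewrite fm => h.
  have : (m%:E <= (m / 2)%:E + (f d * (1 - d))%:E)%E.
    rewrite h leeD//; last exact: (integral_le_sup d01 (lexx 1) cf).
    by rewrite (le_trans (integral_bound_le _ _ d01 cf fA)).
  rewrite -EFinD lee_fin.
  have : f d * (1 - d) <= f d by rewrite ler_piMr//; lra.
  by lra.
apply: (@le_trans _ _ (d `^ (a + 1) * f d)); first by rewrite ler_wpM2l ?powR_ge0.
by have := fi d 1 d0; rewrite d1 lexx powR1 mul1r; exact.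
Qed.

End Mass.

(** * Escape from the neutral fixed point *)

Definition pm_seq {R : realType} (bs : seq R) (f : R -> R) : R -> R :=
  foldl (fun g b => pm_op b g) f bs.

Definition left_seq {R : realType} (bs : seq R) (f : R -> R) : R -> R :=
  foldl (fun g b => left_op b g) f bs.

(* The points of ]0, 1] whose orbit under [bs] stays in [0, 2/3] form
   ]0, trapped bs]. *)
Definition trapped {R : realType} (bs : seq R) : R := foldr (@pm_inv R) 1 bs.

Section Sequences.
Context {R : realType}.
Local Notation mu := (@lebesgue_measure R).
Implicit Types a b c d x y q A M m l k : R.
Implicit Types f g : R -> R.
Implicit Types bs : seq R.

Lemma trapped_itv a bs : {in bs, forall b, 0 < b <= a} -> 0 < trapped bs <= 1.
Proof.
elim: bs => [_|b bs IH ba]; first by rewrite ltr01 lexx.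
have /andP[b0 _] := ba b (mem_head _ _).
have h : 0 < trapped bs <= 1 by apply: IH => c cb; apply: ba; rewrite inE cb orbT.
have /andP[h0 _] := h.
by rewrite /= pm_inv_gt0//= (le_trans (pm_inv_le23 b0 h))//; lra.
Qed.

(** In the coordinate x^(-a), the left inverse branch moves every point up by at least a step
    independent of b: x = y (1 + u) gives x^(-a) <= y^(-a) (1 - a u / 2), and u >= y^a / 2 makes the
    gap at least a/4. *)
Lemma pm_inv_powRN a b x : 0 < b <= a -> a < 1 -> 0 < x <= 1 ->
  x `^ (- a) + a / 4 <= pm_inv b x `^ (- a).
Proof.
move=> ba a1 x01; have /andP[b0 ba1] := ba; have a0 : 0 < a by lra.
have /andP[x0 x1] := x01.
set y := pm_inv b x; have y0 : 0 < y by exact: pm_inv_gt0.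
have y23 : y <= 2 / 3 by exact: pm_inv_le23.
set u := pm_u b y; have u0 : 0 <= u by exact: pm_u_ge0.
have u12 : u <= 2^-1 by apply: pm_u_le_half => //; rewrite (ltW y0).
have yu : y `^ a <= 2 * u by apply: pm_u_ge => //; rewrite y0.
have u1 : 0 < 1 + u by lra.
have B : (1 + u) `^ (- a) <= 1 - a * (u / 2).
  have i0 : 0 < (1 + u)^-1 by rewrite invr_gt0.
  have := @powR_bernoulli_le _ a (1 + u)^-1; rewrite (ltW a0) (ltW a1) => /(_ isT i0).
  rewrite -(@powR_inv1 _ (1 + u)) ?(ltW u1)// -powRrM mulN1r powR_inv1 ?(ltW u1)// => h.
  apply: (le_trans h); rewrite lerD2l -mulrN ler_wpM2l ?(ltW a0)//.
  rewrite lerBlDr -(@ler_pM2r _ (1 + u))// mulVf ?gt_eqF//.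
  have : u * u <= u * 2^-1 by rewrite ler_wpM2l.
  lra.
have ya0 : 0 < y `^ a by exact: powR_gt0.
have -> : x `^ (- a) = y `^ (- a) * (1 + u) `^ (- a).
  by rewrite -powRM ?ltW// -pm_leftE// ?pm_invK// ltW.
apply: (@le_trans _ _ (y `^ (- a) * (1 - a * (u / 2)) + a / 4)).
  by rewrite lerD2r ler_wpM2l ?powR_ge0.
rewrite powRN mulrBr mulr1 -addrA gerDl addrC subr_le0.
rewrite mulrCA ler_pM2l// mulrC ler_pdivlMr//.
lra.
Qed.

Lemma trapped_powRN a bs : a < 1 -> {in bs, forall b, 0 < b <= a} ->
  1 + (size bs)%:R * (a / 4) <= trapped bs `^ (- a).
Proof.
move=> a1; elim: bs => [_|b bs IH ba]; first by rewrite mul0r addr0 powR1.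
have ba' : {in bs, forall b, 0 < b <= a}.
  by move=> c cb; apply: ba; rewrite inE cb orbT.
have := pm_inv_powRN (ba b (mem_head _ _)) a1 (trapped_itv ba').
apply: le_trans; rewrite [size _]/= -natr1 mulrDl mul1r addrA.
by rewrite lerD2r IH.
Qed.

Lemma integral_left_seq a bs f : {in bs, forall b, 0 < b <= a} -> cone a f ->
  (\int[mu]_(t in `]0%R, 1%R]) (left_seq bs f t)%:E =
   \int[mu]_(t in `]0%R, trapped bs]) (f t)%:E)%E.
Proof.
elim: bs f => [//|b bs IH] f ba cf.
have ba' : {in bs, forall b, 0 < b <= a}.
  by move=> c cb; apply: ba; rewrite inE cb orbT.
have bb := ba b (mem_head _ _); have /andP[b0 _] := bb.
have [f1 f2 _ _] := cf.
rewrite /= IH//; last exact: cone_left_op.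
exact: (integral_left_op_inv b0 (trapped_itv ba') f1 f2).
Qed.

Lemma pm_seqD bs f g :
  pm_seq bs (fun x => f x + g x) = fun x => pm_seq bs f x + pm_seq bs g x.
Proof.
elim: bs f g => [//|b bs IH] f g /=; rewrite -IH; congr (pm_seq bs _).
by apply/funext => x; rewrite /pm_op /left_op /right_op; ring.
Qed.

Lemma pm_op_ge b f g k : 0 < b ->
  (forall x, 0 < x <= 1 -> k * g x <= f x) ->
  forall x, 0 < x <= 1 -> k * pm_op b g x <= pm_op b f x.
Proof.
move=> b0 fg x /[dup] x01 /andP[x0 x1]; rewrite /pm_op mulrDr lerD//.
  rewrite /left_op mulrA ler_wpM2r ?invr_ge0 ?(le_trans _ (pm_leftD_ge1 _ b0))// fg//.
  by rewrite pm_inv_gt0//= (le_trans (pm_inv_le23 b0 x01))//; lra.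
by rewrite /right_op mulrA ler_wpM2r ?invr_ge0// fg//; apply/andP; split; lra.
Qed.

Lemma pm_seq_ge bs f g k : {in bs, forall b, 0 < b} ->
  (forall x, 0 < x <= 1 -> k * g x <= f x) ->
  forall x, 0 < x <= 1 -> k * pm_seq bs g x <= pm_seq bs f x.
Proof.
elim: bs f g => [//|b bs IH] f g b0 fg x x01; apply: IH => //.
  by move=> c cb; apply: b0; rewrite inE cb orbT.
by apply: pm_op_ge => //; apply: b0; exact: mem_head.
Qed.

Lemma cone_pm_seq a bs f : {in bs, forall b, 0 < b <= a} -> cone a f ->
  cone a (pm_seq bs f).
Proof.
elim: bs f => [//|b bs IH] f ba cf; apply: IH.
  by move=> c cb; apply: ba; rewrite inE cb orbT.
by apply: cone_pm_op => //; apply: ba; exact: mem_head.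
Qed.

Lemma integral_pm_seq a bs f : {in bs, forall b, 0 < b <= a} -> cone a f ->
  (\int[mu]_(t in `]0%R, 1%R]) (pm_seq bs f t)%:E =
   \int[mu]_(t in `]0%R, 1%R]) (f t)%:E)%E.
Proof.
elim: bs f => [//|b bs IH] f ba cf; have bb := ba b (mem_head _ _).
rewrite IH; first exact: (integral_pm_op bb).
  by move=> c cb; apply: ba; rewrite inE cb orbT.
exact: cone_pm_op.
Qed.

Lemma cone_le_mass a f m : cone a f ->
  (\int[mu]_(t in `]0%R, 1%R]) (f t)%:E = m%:E)%E ->
  forall x, 0 < x <= 1 -> x * f x <= m.
Proof.
move=> cf fm x /andP[x0 x1]; have [f1 f0 fd _] := cf.
rewrite -lee_fin -fm.
apply: (@le_trans _ _ (\int[mu]_(t in `]0%R, x]) (cst (f x)%:E t))%E).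
  by rewrite integral_cst//= lebesgue_measure_itv/= lte_fin x0 oppr0 adde0 EFinM muleC.
apply: (@le_trans _ _ (\int[mu]_(t in `]0%R, x]) (f t)%:E)%E).
  apply: ge0_le_integral => //=.
  - by move=> t _; rewrite lee_fin f0// x0.
  - apply: (cone_measurable _ _ cf) => //.
    by apply: subset_itv; rewrite bnd_simp.
  - by move=> z; rewrite in_itv/= lee_fin => /andP[? ?]; apply: fd => //; rewrite x1 andbT.
apply: ge0_subset_integral => //=.
- apply: (cone_measurable _ _ cf) => //.
  by apply: subset_itv; rewrite bnd_simp.
- by apply: subset_itv; rewrite bnd_simp.
Qed.

Lemma pm_seq_bound a bs f A M m : 0 < a < 1 -> {in bs, forall b, 0 < b <= a} ->
  cone a f -> (\int[mu]_(t in `]0%R, 1%R]) (f t)%:E = m%:E)%E ->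
  m <= M -> 3 * M <= A * (1 - a) -> 0 <= A ->
  (forall x, 0 < x <= 1 -> f x <= A * x `^ (- a)) ->
  forall x, 0 < x <= 1 -> pm_seq bs f x <= A * x `^ (- a).
Proof.
move=> a01; elim: bs f => [//|b bs IH] f ba cf fm mM MA A0 fA.
have bb := ba b (mem_head _ _); have /andP[_ a1] := a01.
apply: IH => //; first by move=> c cb; apply: ba; rewrite inE cb orbT.
- exact: cone_pm_op.
- by rewrite (integral_pm_op bb).
- apply: (pm_op_bound bb a1 cf _ MA A0 fA).
  have s01 : 0 < (2 / 3 : R) <= 1 by lra.
  by have := cone_le_mass cf fm s01; lra.
Qed.

(* Mass that leaves [0, 2/3] at some time during [bs] re-enters through the
   right branch, as a multiple of a constant density. *)
Lemma pm_seq_lower a bs f k m l : 0 < a < 1 -> 0 <= k ->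
  {in bs, forall b, 0 < b <= a} ->
  (forall cs, {in cs, forall b, 0 < b <= a} ->
    forall x, 0 < x <= 1 -> k <= pm_seq cs (fun=> 1) x) ->
  cone a f ->
  (\int[mu]_(t in `]0%R, 1%R]) (f t)%:E = m%:E)%E ->
  (\int[mu]_(t in `]0%R, 1%R]) (left_seq bs f t)%:E = l%:E)%E ->
  forall x, 0 < x <= 1 -> 4 / 9 * k * (m - l) <= pm_seq bs f x.
Proof.
move=> a01 k0 + H; elim: bs f m l => [|b bs IH] f m l ba cf fm fl x x01.
  by move: fl; rewrite /= fm => -[->]; rewrite subrr mulr0; have [_ f0 _ _] := cf; exact: f0.
have ba' : {in bs, forall b, 0 < b <= a}.
  by move=> c cb; apply: ba; rewrite inE cb orbT.
have bb := ba b (mem_head _ _); have /andP[b0 _] := bb.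
have [f1 f0 fd fi] := cf.
have f10 : 0 <= f 1 by apply: f0; rewrite ltr01 lexx.
have s01 : 0 < (2 / 3 : R) <= 1 by lra.
have split := integral_oc0_split s01 (lexx 1) cf.
have lop : (\int[mu]_(t in `]0%R, 1%R]) (left_op b f t)%:E =
    \int[mu]_(t in `]0%R, (2 / 3)%R]) (f t)%:E)%E.
  by rewrite -(pm_inv1 b0); apply: integral_left_op_inv; rewrite // ltr01 lexx.
have tail := integral_le_sup s01 (lexx 1) cf.
(* 9/4 is (2/3)^(-2), as a + 1 <= 2. Hence the mass on ]2/3, 1] is at most 3/4 f(1), while
   [right_op f] is at least f(1)/3; the quotient of 1/3 and 3/4 is the 4/9 of the statement. *)
have f23 : f (2 / 3) <= 9 / 4 * f 1.
  have h2 : (2 / 3) `^ (a + 1) * f (2 / 3) <= f 1.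
    have /andP[s0 s1] := s01; have := fi _ 1 s0.
    by rewrite s1 lexx powR1 mul1r; exact.
  have : (2 / 3 : R) `^ 2%:R <= (2 / 3) `^ (a + 1) by apply: ger_powR; lra.
  rewrite powR_mulrn; last by lra.
  move=> h1; have f230 := f0 _ s01.
  have : (2 / 3) ^+ 2 * f (2 / 3) <= f 1 by apply: le_trans h2; rewrite ler_wpM2r.
  rewrite expr2; lra.
have [m' m'E] : exists m', (\int[mu]_(t in `]0%R, (2 / 3)%R]) (f t)%:E = m'%:E)%E.
  move: split; rewrite fm.
  have : (0 <= \int[mu]_(t in `](2 / 3)%R, 1%R]) (f t)%:E)%E.
    by apply: integral_ge0 => t; rewrite /= in_itv/= lee_fin => ?; apply: f0; lra.
  have : (0 <= \int[mu]_(t in `]0%R, (2 / 3)%R]) (f t)%:E)%E.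
    by apply: integral_ge0 => t; rewrite /= in_itv/= lee_fin => ?; apply: f0; lra.
  case: (\int[mu]_(t in `]0%R, (2 / 3)%R]) (f t)%:E)%E => [r| |]//.
    by move=> _ _ _; exists r.
  by case: (\int[mu]_(t in `](2 / 3)%R, 1%R]) (f t)%:E)%E.
have mm' : m - m' <= 3 / 4 * f 1.
  have : (m%:E <= m'%:E + (f (2 / 3) * (1 - 2 / 3))%:E)%E.
    by rewrite -fm split m'E leeD2l.
  by rewrite -EFinD lee_fin; lra.
have IHl := IH (left_op b f) m' l ba' (cone_left_op bb cf) _ fl x x01.
rewrite lop m'E in IHl; have {}IHl := IHl erefl.
rewrite /= /pm_op (pm_seqD bs (left_op b f) (right_op f)).
have Hr : f 1 / 3 * pm_seq bs (fun=> 1) x <= pm_seq bs (right_op f) x.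
  apply: pm_seq_ge => // [c /ba'/andP[]//|z z01].
  rewrite mulr1 /right_op ler_wpM2r// fd//; lra.
have Hk := H bs ba' x x01.
have : f 1 / 3 * k <= f 1 / 3 * pm_seq bs (fun=> 1) x by rewrite ler_wpM2l// divr_ge0.
have : k * (m - m') <= k * (3 / 4 * f 1) by rewrite ler_wpM2l.
lra.
Qed.

End Sequences.

(** * Coupling *)

Section Coupling.
Context {R : realType}.
Local Notation mu := (@lebesgue_measure R).
Implicit Types a b c d x y q A K M m l k : R.
Implicit Types f g : R -> R.
Implicit Types bs : seq R.

Lemma powR_root s c : 0 < s -> 0 < c <= 1 -> exists2 d : R, 0 < d <= 1 & d `^ s = c.
Proof.
move=> s0 /andP[c0 c1]; exists (c `^ s^-1).
  rewrite powR_gt0//= -(powRr0 c) ger_powR ?c0//.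
  by rewrite invr_ge0 ltW.
by rewrite -powRrM mulVf ?gt_eqF// powRr1// ltW.
Qed.

Lemma pm_seq_one_ge a : 0 < a < 1 -> exists2 k : R, 0 < k <= 1 &
  forall bs, {in bs, forall b, 0 < b <= a} ->
  forall x, 0 < x <= 1 -> k <= pm_seq bs (fun=> 1) x.
Proof.
move=> a01; have /andP[a0 a1] := a01; have a1' : 0 < 1 - a by lra.
pose A := 3 / (1 - a); have A3 : 3 <= A by rewrite ler_pdivlMr//; lra.
have [|d d01 dE] := @powR_root (1 - a) ((1 - a) / (2 * A)) a1'.
  apply/andP; split; first by rewrite divr_gt0//; lra.
  by rewrite ler_pdivrMr; lra.
have /andP[d0 d1] := d01.
have k0 : 0 < d `^ (a + 1) * (1 / 2) by rewrite mulr_gt0// powR_gt0.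
have H bs : {in bs, forall b, 0 < b <= a} ->
    forall x, 0 < x <= 1 -> d `^ (a + 1) * (1 / 2) <= pm_seq bs (fun=> 1) x.
  move=> ba x /andP[x0 x1].
  have c1 : cone a (fun=> 1) by apply: cone_cst; rewrite // ltW.
  have cs := cone_pm_seq ba c1; have [_ _ fd _] := cs.
  have i1 : (\int[mu]_(t in `]0%R, 1%R]) 1%:E = 1%:E)%E := integral_oc01_cst 1.
  apply: (@le_trans _ _ (pm_seq bs (fun=> 1) 1)); last by apply: fd; rewrite // x1 lexx.
  apply: (@cone_at1_ge _ a A) => //; first by lra.
  - apply: (pm_seq_bound a01 ba c1 i1 (lexx 1)); first by rewrite divfK ?gt_eqF//; lra.
      by lra.
    move=> y /andP[y0 y1].
    have : 1 <= y `^ (- a) by rewrite -(powRr0 y) ger_powR ?y0//; lra.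
    have : 0 <= y `^ (- a) by exact: powR_ge0.
    nra.
  - by rewrite (integral_pm_seq ba c1).
  - rewrite dE; have A0 : A != 0 by rewrite gt_eqF//; lra.
    by rewrite le_eqVlt; apply/orP; left; apply/eqP; field; rewrite A0 gt_eqF.
exists (d `^ (a + 1) * (1 / 2)) => //; rewrite k0/=.
(* The empty sequence leaves the density 1 unchanged, which gives k <= 1. *)
by have := H [::] (fun _ h => False_ind _ (notF h)) 1; rewrite ltr01 lexx; exact.
Qed.

(* [K * M] rather than [K * m] in the bound: it stays the same while the
   uncoupled mass [m] shrinks. *)
Definition uncoupled a K M m f := [/\ cone a f,
  forall x, 0 < x <= 1 -> f x <= K * M * x `^ (- a) &
  (\int[mu]_(t in `]0%R, 1%R]) (f t)%:E = m%:E)%E].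

Lemma pm_seq_uncoupled a K M m bs f : 0 < a < 1 -> 3 <= K * (1 - a) ->
  0 <= m <= M -> {in bs, forall b, 0 < b <= a} ->
  uncoupled a K M m f -> uncoupled a K M m (pm_seq bs f).
Proof.
move=> a01 K3 /andP[m0 mM] ba [cf fK fm]; have /andP[a0 a1] := a01.
have M0 : 0 <= M by lra.
have K0 : 0 <= K by rewrite -(@pmulr_lge0 _ (1 - a))//; lra.
split; first exact: cone_pm_seq.
  apply: (pm_seq_bound a01 ba cf fm mM) => //; last by rewrite mulr_ge0.
  by rewrite mulrAC ler_wpM2r.
by rewrite (integral_pm_seq ba cf).
Qed.

(** Half of the mass has left through the right branch during [bs], so the density at 1 is at least
    4/9 k (m/2) = 2/9 k m; [cone_pm_op_sub] allows the removal of 2/9 of this, that is 4/81 k m. The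
    extra map [b] is there because the constant comes off the image under one more operator. *)
Lemma uncoupled_step a K M m k bs b f : 0 < a < 1 -> 3 <= K * (1 - a) ->
  0 < k <= 1 ->
  (forall cs, {in cs, forall b, 0 < b <= a} ->
    forall x, 0 < x <= 1 -> k <= pm_seq cs (fun=> 1) x) ->
  0 <= m <= M -> {in bs, forall b, 0 < b <= a} -> 0 < b <= a ->
  K * M * (trapped bs `^ (1 - a) / (1 - a)) <= m / 2 ->
  uncoupled a K M m f ->
  uncoupled a K M ((1 - 4 / 81 * k) * m)
    (fun x => pm_op b (pm_seq bs f) x - 4 / 81 * k * m).
Proof.
move=> a01 K3 /andP[k0 k1] H mM ba bb tr uf; have [cf fK fm] := uf.
have /andP[a0 a1] := a01; have /andP[m0 mM'] := mM.
have M0 : 0 <= M by lra.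
have K0 : 0 <= K by rewrite -(@pmulr_lge0 _ (1 - a))//; lra.
have [cp pK pm] := pm_seq_uncoupled a01 K3 mM ba uf.
have [l lE] : exists l : R, (\int[mu]_(t in `]0%R, 1%R]) (left_seq bs f t)%:E = l%:E)%E /\ l <= m / 2.
  rewrite (integral_left_seq ba cf).
  have le := integral_bound_le a01 (mulr_ge0 K0 M0) (trapped_itv ba) cf fK.
  have : (0 <= \int[mu]_(t in `]0%R, trapped bs]) (f t)%:E)%E.
    have [_ f0 _ _] := cf; have := trapped_itv ba.
    by move=> /andP[? ?]; apply: integral_ge0 => t; rewrite /= in_itv/= lee_fin => ?; apply: f0; lra.
  move: le; case: (\int[mu]_(t in `]0%R, trapped bs]) (f t)%:E)%E => [r| |]//.
  by rewrite lee_fin => h _; exists r; split => //; exact: le_trans tr.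
have low := pm_seq_lower a01 (ltW k0) ba H cf fm lE.1.
have p1 : 2 / 9 * k * m <= pm_seq bs f 1.
  have := low 1; rewrite ltr01 lexx => /(_ isT); apply: le_trans.
  rewrite (_ : 2 / 9 * k * m = 4 / 9 * k * (m / 2)); last by field.
  by rewrite ler_wpM2l//; [rewrite mulr_ge0// ltW|lra].
have c0 : 0 <= 4 / 81 * k * m by rewrite !mulr_ge0// ltW.
have cc : 0 <= 4 / 81 * k * m <= 2 / 9 * pm_seq bs f 1.
  by rewrite c0/=; lra.
have cg := cone_pm_op_sub bb cp cc; have [_ g0 _ _] := cg.
have bs1 : {in [:: b], forall b, 0 < b <= a} by move=> c; rewrite inE => /eqP ->.
have [[co _ _ _] oK om] := pm_seq_uncoupled a01 K3 mM bs1 (And3 cp pK pm).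
split => //.
  by move=> x x01; rewrite lerBlDr (le_trans (oK x x01))// lerDl.
rewrite (@integral_sub_cst _ _ m)//; congr EFin; ring.
Qed.

Lemma pm_seqB bs f f' g g' : (forall x, f x - f' x = g x - g' x) ->
  forall x, pm_seq bs f x - pm_seq bs f' x = pm_seq bs g x - pm_seq bs g' x.
Proof.
move=> e x.
have : pm_seq bs (fun x => f x + g' x) x = pm_seq bs (fun x => f' x + g x) x.
  congr (pm_seq bs _ x); apply/funext => z.
  by apply/eqP; rewrite -subr_eq0; apply/eqP; have := e z; lra.
by rewrite !pm_seqD; lra.
Qed.

Lemma pm_seq_cat bs1 bs2 f : pm_seq (bs1 ++ bs2) f = pm_seq bs2 (pm_seq bs1 f).
Proof. exact: foldl_cat. Qed.

Lemma trapped_powR_le a bs y : 0 < a < 1 -> {in bs, forall b, 0 < b <= a} ->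
  0 < y -> y <= (size bs)%:R ->
  trapped bs `^ (1 - a) <= (y * (a / 4)) `^ (- (a^-1 - 1)).
Proof.
move=> /andP[a0 a1] ba y0 yn.
have ya : 0 < y * (a / 4) by rewrite mulr_gt0// divr_gt0.
have /andP[z0 _] := trapped_itv ba.
have -> : 1 - a = - a * - (a^-1 - 1) by field; rewrite gt_eqF.
rewrite powRrM !(powRN _ (a^-1 - 1)) lef_pV2 ?posrE ?powR_gt0//.
have p0 : 0 <= a^-1 - 1 by rewrite subr_ge0 invf_ge1// ltW.
apply: ge0_ler_powR => //; rewrite ?nnegrE ?powR_ge0 ?(ltW ya)//.
apply: (le_trans _ (trapped_powRN a1 ba)).
have : y * (a / 4) <= (size bs)%:R * (a / 4) by rewrite ler_wpM2r// divr_ge0// ltW.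
lra.
Qed.

Lemma coupling_rate a K : 0 < a < 1 -> 3 <= K * (1 - a) ->
  exists2 C : R, 0 <= C & forall M f f' bs, 0 <= M ->
    {in bs, forall b, 0 < b <= a} -> (0 < size bs)%N ->
    uncoupled a K M M f -> uncoupled a K M M f' ->
    exists m g g', [/\ 0 <= m <= C * M * (size bs)%:R `^ (- a^-1 + 1),
      uncoupled a K M m g, uncoupled a K M m g' &
      forall x, pm_seq bs f x - pm_seq bs f' x = g x - g' x].
Proof.
move=> a01 K3; have /andP[a0 a1] := a01; have a1' : 0 < 1 - a by lra.
have K0 : 0 < K by rewrite -(@pmulr_lgt0 _ (1 - a))//; lra.
have [k k01 H] := pm_seq_one_ge a01; have /andP[k0 k1] := k01.
set q := 1 - 4 / 81 * k.
have q01 : 0 < q < 1 by apply/andP; split; rewrite /q; lra.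
have /andP[q0 q1] := q01.
set p := a^-1 - 1; have p0 : 0 < p by rewrite subr_gt0 invf_gt1.
(* Growth factor of the block lengths, chosen so that r^(-p) = q. *)
pose r := q `^ (- p^-1).
have rp : r `^ (- p) = q.
  by rewrite -powRrM mulrNN mulVf ?gt_eqF// powRr1// ltW.
have r1 : 1 < r.
  rewrite /r powRN invf_gt1 ?powR_gt0//.
  have := @gt0_ltr_powR R p^-1; rewrite invr_gt0 => /(_ p0 q 1).
  by rewrite !nnegrE ler01 ltW// powR1; exact.
have rj j : (r ^+ j) `^ (- p) = q ^+ j.
  by rewrite -powR_mulrn ?ltW ?(lt_trans ltr01)// powRAC rp powR_mulrn// ltW.
have rj1 j : 1 <= r ^+ j by rewrite exprn_ege1// ltW.
(* A block of length C1 r^j traps at most K M e q^j / (1 - a) = q^j M / 2, half of the mass left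
   after j removals. *)
pose e := (1 - a) / (2 * K); have e0 : 0 < e by rewrite divr_gt0// mulr_gt0.
pose C1 := e `^ (- p^-1) * (4 / a).
have C10 : 0 < C1 by rewrite mulr_gt0 ?powR_gt0// divr_gt0.
(* C2 (r^j - 1) is the geometric sum of the (C1 + 2) r^i over i < j. Of the extra 2, one unit covers
   rounding to an integer and one the map at which the constant is removed. *)
pose C2 := (C1 + 2) / (r - 1).
have C20 : 0 < C2 by rewrite divr_gt0 ?subr_gt0// addr_gt0.
have C2r : C2 * (r - 1) = C1 + 2 by rewrite divfK// gt_eqF// subr_gt0.
have C1E y : 0 < y -> (C1 * y * (a / 4)) `^ (- p) = e * y `^ (- p).
  move=> y0; have -> : C1 * y * (a / 4) = e `^ (- p^-1) * y.
    by rewrite /C1; field; rewrite gt_eqF.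
  by rewrite powRM ?powR_ge0 ?(ltW y0)// -powRrM mulrNN mulVf ?gt_eqF// powRr1// ltW.
have iter M f f' : 0 <= M -> uncoupled a K M M f -> uncoupled a K M M f' ->
    forall j bs, {in bs, forall b, 0 < b <= a} -> C2 * (r ^+ j - 1) <= (size bs)%:R ->
    exists g g', [/\ uncoupled a K M (q ^+ j * M) g, uncoupled a K M (q ^+ j * M) g' &
      forall x, pm_seq bs f x - pm_seq bs f' x = g x - g' x].
  move=> M0 uf uf'; elim => [|j IH] bs ba sz.
    have MM : 0 <= M <= M by rewrite M0 lexx.
    exists (pm_seq bs f), (pm_seq bs f'); rewrite expr0 mul1r.
    by split => //; apply: pm_seq_uncoupled.
  (* The first N maps make the j removals of the induction hypothesis. All the others form the next
     block, however many there are, so that the whole of [bs] is consumed; the last of them carries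
     the removal. *)
  set N := (Num.truncn (C2 * (r ^+ j - 1))).+1.
  have t0 : 0 <= C2 * (r ^+ j - 1) by rewrite mulr_ge0 ?(ltW C20)// subr_ge0.
  have N1 : C2 * (r ^+ j - 1) <= N%:R by rewrite ltW// truncnS_gt.
  have N2 : N%:R <= C2 * (r ^+ j - 1) + 1.
    by rewrite -natr1 lerD2r truncn_le.
  have big : N%:R + 1 + C1 * r ^+ j <= (size bs)%:R.
    apply: (le_trans _ sz); rewrite exprS.
    have : (C1 + 2) * r ^+ j = C2 * (r * r ^+ j - r ^+ j) by rewrite -C2r; ring.
    have := rj1 j; lra.
  have C1r : 0 < C1 * r ^+ j by rewrite mulr_gt0// (lt_le_trans ltr01).
  have Nsz : (N < size bs)%N by rewrite -(ltr_nat R); lra.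
  have szN : C2 * (r ^+ j - 1) <= (size (take N bs))%:R by rewrite size_takel// ltnW.
  have [g [g' [ug ug' gg]]] := IH (take N bs) (fun b h => ba b (mem_take h)) szN.
  have : size (drop N bs) = (size bs - N)%N by rewrite size_drop.
  have : {in drop N bs, forall b, 0 < b <= a} by move=> b /mem_drop; exact: ba.
  have : bs = take N bs ++ drop N bs by rewrite cat_take_drop.
  case/lastP: (drop N bs) => [_ _ /esym/eqP|bs2 b bsE ba2 sz2].
    by rewrite subn_eq0 leqNgt Nsz.
  have ba2' : {in bs2, forall b, 0 < b <= a}.
    by move=> c cb; apply: ba2; rewrite mem_rcons inE cb orbT.
  have bb : 0 < b <= a by apply: ba2; rewrite mem_rcons mem_head.
  have sz3 : C1 * r ^+ j <= (size bs2)%:R.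
    have : (size bs2)%:R + 1 + N%:R = (size bs)%:R :> R.
      by rewrite natr1 -natrD; congr (_%:R); move: sz2; rewrite size_rcons => ->; rewrite subnK// ltnW.
    lra.
  have qj0 : 0 <= q ^+ j * M by rewrite mulr_ge0// exprn_ge0// ltW.
  have qM : 0 <= q ^+ j * M <= M.
    by rewrite qj0/= ler_piMl// exprn_ile1// ltW.
  have tr : K * M * (trapped bs2 `^ (1 - a) / (1 - a)) <= q ^+ j * M / 2.
    have := trapped_powR_le a01 ba2' C1r sz3.
    rewrite -/p C1E ?rj; last exact: lt_le_trans (rj1 j).
    move=> h; rewrite mulrA ler_pdivrMr//.
    apply: (@le_trans _ _ (K * M * (e * q ^+ j))).
      by rewrite ler_wpM2l// mulr_ge0// ltW.
    rewrite le_eqVlt; apply/orP; left; apply/eqP.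
    by rewrite /e; field; rewrite gt_eqF.
  exists (fun x => pm_op b (pm_seq bs2 g) x - 4 / 81 * k * (q ^+ j * M)).
  exists (fun x => pm_op b (pm_seq bs2 g') x - 4 / 81 * k * (q ^+ j * M)).
  rewrite exprS -mulrA; split.
  - exact: (uncoupled_step a01 K3 k01 H qM ba2' bb tr ug).
  - exact: (uncoupled_step a01 K3 k01 H qM ba2' bb tr ug').
  - move=> x; rewrite bsE !pm_seq_cat (pm_seqB _ gg).
    rewrite -cats1 !pm_seq_cat /=; ring.
(* For the largest j whose removals fit into n maps, n < C2 (r^(j+1) - 1) < C2 r r^j. Raising to the
   power -p turns r^j into q^j: q^j <= (C2 r)^p n^(-p). *)
exists ((C2 * r) `^ p); first exact: powR_ge0.
move=> M f f' bs M0 ba sz uf uf'.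
have : exists J, (size bs)%:R < C2 * (r ^+ J - 1).
  set t := (size bs)%:R / (C2 * (r - 1)).
  have [n tn] : exists n : nat, t < n%:R by exists (Num.truncn t).+1; exact: truncnS_gt.
  exists n; have rr : 0 < C2 * (r - 1) by rewrite mulr_gt0// subr_gt0.
  rewrite /t ltr_pdivrMr// in tn; apply: (lt_le_trans tn).
  rewrite mulrCA ler_pM2l// lerBrDl -[in leRHS](subrKC 1 r) -powR_mulrn; last first.
    by rewrite subrKC ltW// (lt_trans ltr01).
  case: n {tn} => [|n]; first by rewrite mul0r addr0 powRr0.
  by rewrite powR_bernoulli_ge// ?ler1n// subr_ge0 ltW.
move=> /ex_minnP[J JP Jmin].
case: J JP Jmin => [|j]; first by rewrite expr0 subrr mulr0 ltNge ler0n.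
move=> jP /(_ j); rewrite ltnn => jmin.
have jle : C2 * (r ^+ j - 1) <= (size bs)%:R.
  by rewrite leNgt; apply/negP => /jmin.
have [g [g' [ug ug' gg]]] := iter M f f' M0 uf uf' j bs ba jle.
exists (q ^+ j * M), g, g'; split => //.
rewrite mulr_ge0 ?exprn_ge0 ?(ltW q0)//= mulrAC ler_wpM2r//.
have r0 : 0 < r by rewrite (lt_trans ltr01).
have n0 : 0 < (size bs)%:R :> R by rewrite ltr0n.
have -> : - a^-1 + 1 = - p by rewrite /p opprB addrC.
set c := C2 * r; have c0 : 0 < c by rewrite mulr_gt0.
have -> : c `^ p = c^-1 `^ (- p) by rewrite -(powR_inv1 (ltW c0)) -powRrM mulN1r opprK.
rewrite -powRM ?invr_ge0 ?(ltW c0) ?(ltW n0)// -rj !powRN.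
have cn0 : 0 < c^-1 * (size bs)%:R by rewrite mulr_gt0// invr_gt0.
have rj0 : 0 < r ^+ j by exact: lt_le_trans (rj1 j).
rewrite lef_pV2 ?posrE ?powR_gt0//.
apply: ge0_ler_powR; rewrite ?nnegrE ?(ltW p0) ?(ltW cn0) ?(ltW rj0)//.
by rewrite mulrC ler_pdivrMr//; move: jP; rewrite exprS /c; lra.
Qed.

End Coupling.

(** * From [pm_op] back to the transfer operators and [cone2] *)

Section Transfer.
Context {R : realType}.
Local Notation mu := (@lebesgue_measure R).
Implicit Types a b c d x y q A K M m t : R.
Implicit Types f g phi psi : R -> R.
Implicit Types bs : seq R.

Lemma transfer_pm_op b f g : 0 < b -> (forall x, 0 < x <= 1 -> f x = g x) ->
  forall x, 0 < x <= 1 -> transfer b f x = pm_op b g x.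
Proof.
move=> b0 fg x /[dup] x01 /andP[x0 x1].
have i0 := pm_inv_gt0 b0 x0; have i23 := pm_inv_le23 b0 x01.
rewrite /transfer branch_preimage_left// branch_preimage_right//.
rewrite derive1_pm_left// derive1_pm_right /pm_op /left_op /right_op.
by congr (_ / _ + _ / _); apply: fg; apply/andP; split; lra.
Qed.

Lemma transfer_seq_pm_seq bs f g : {in bs, forall b, 0 < b} ->
  (forall x, 0 < x <= 1 -> f x = g x) ->
  forall x, 0 < x <= 1 -> transfer_seq bs f x = pm_seq bs g x.
Proof.
elim: bs f g => [//|b bs IH] f g b0 fg; apply: IH.
  by move=> c cb; apply: b0; rewrite inE cb orbT.
by apply: transfer_pm_op => //; apply: b0; exact: mem_head.
Qed.

Lemma transfer_seqD bs f g :
  transfer_seq bs (fun x => f x + g x) = fun x => transfer_seq bs f x + transfer_seq bs g x.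
Proof.
elim: bs f g => [//|b bs IH] f g; rewrite /= -IH; congr (transfer_seq bs _).
by apply/funext => x; rewrite /transfer; ring.
Qed.

(** Freezing phi at the value phi(1) beyond 1 supplies the two-sided continuity that [cone] demands,
    without changing phi on ]0, 1]. *)
Lemma min1_continuous phi : {within `]0, 1], continuous phi} ->
  forall x, 0 < x -> {for x, continuous (fun y => phi (Num.min y 1))}.
Proof.
move=> /subspace_continuousP cphi x x0.
have x01 : `]0, 1]%classic (Num.min x 1).
  by rewrite /= in_itv/= lt_min x0 ltr01 ge_min lexx orbT.
have cmin : Num.min y 1 @[y --> x] --> Num.min x 1.
  by apply: continuous_min; [exact: cvg_id|exact: cvg_cst].
apply: (@cvg_comp _ _ _ (fun y => Num.min y 1) phi _ _ _ _ (cphi _ x01)).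
move=> B /= /cmin; apply: filterS2 (lt_nbhsr x0) => y y0 /=; apply.
by rewrite in_itv/= lt_min y0 ltr01 ge_min lexx orbT.
Qed.

Lemma cone2_uncoupled a c K phi : cone2 a c phi -> 0 < a < 1 -> c <= K ->
  [/\ 0 <= expectation01 phi,
    L1norm phi = (expectation01 phi)%:E &
    uncoupled a K (expectation01 phi) (expectation01 phi)
      (fun x => phi (Num.min x 1))].
Proof.
move=> [[cphi phi0 phid phii] iphi phib] a01 cK.
have mphi : measurable_fun (`]0, 1]%classic : set R) (EFin \o phi).
  apply: (measurable_funS _ _ (measurable_int _ iphi)) => //.
  by apply: subset_itv; rewrite bnd_simp.
have EE : (\int[mu]_(x in `]0%R, 1%R]) (phi x)%:E = (expectation01 phi)%:E)%E.
  rewrite integral_itv_obnd_cbnd// /expectation01 /Rintegral fineK//.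
  exact: integrable_fin_num.
have L : L1norm phi = (expectation01 phi)%:E.
  rewrite /L1norm -integral_itv_obnd_cbnd; last first.
    by apply/measurable_EFinP; apply: measurableT_comp => //; exact/measurable_EFinP.
  rewrite -EE; apply: eq_integral => x; rewrite inE/= => x01.
  by rewrite ger0_norm// phi0.
have E0 : 0 <= expectation01 phi.
  by rewrite -lee_fin -EE; apply: integral_ge0 => x x01; rewrite lee_fin phi0.
have min1 x : x <= 1 -> Num.min x 1 = x by move=> x1; exact/min_idPl.
split => //; split.
- split.
  + exact: min1_continuous.
  + move=> x /andP[x0 x1]; rewrite min1//; apply: phi0.
    by rewrite in_itv/= x0.
  + move=> x y x0 /andP[xy y1]; rewrite !min1//; last exact: le_trans y1.
    by apply: phid => //; rewrite in_itv/= ?(lt_le_trans x0)//= ?x0 (le_trans xy).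
  + move=> x y x0 /andP[xy y1]; rewrite !min1//; last exact: le_trans y1.
    by apply: phii => //; rewrite in_itv/= ?(lt_le_trans x0)//= ?x0 (le_trans xy).
- move=> x x01; have /andP[x0 x1] := x01; rewrite min1//.
  have := phib x; rewrite in_itv/= x01 => /(_ isT) /le_trans; apply.
  rewrite mulrAC ler_wpM2r ?powR_ge0//.
  by rewrite ler_wpM2r.
- rewrite -EE; apply: eq_integral => x; rewrite inE/= in_itv/= => /andP[_ x1].
  by rewrite min1.
Qed.

Lemma memory_loss a K : 0 < a < 1 -> 3 <= K * (1 - a) ->
  exists2 C : R, 0 <= C & forall c phi psi bs, c <= K ->
    cone2 a c phi -> cone2 a c psi -> expectation01 phi = expectation01 psi ->
    {in bs, forall b, 0 < b <= a} -> (1 < size bs)%N ->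
    (L1norm (fun x => (transfer_seq bs phi x - transfer_seq bs psi x)%R) <=
     (C * (2 * expectation01 phi) * loss_rate a (size bs))%:E)%E.
Proof.
move=> a01 K3; have /andP[a0 a1] := a01.
have [C C0 HC] := coupling_rate a01 K3.
have ln20 : 0 < ln (2 : R) by rewrite ln_gt0// ltr1n.
(* The coupling gives the rate without logarithm; for n >= 2 the logarithmic factor is at least s,
   so dividing the constant by s inserts it. *)
set s := ln (2 : R) `^ a^-1; have s0 : 0 < s by exact: powR_gt0.
exists (C / s); first by rewrite divr_ge0// ltW.
move=> c phi psi bs cK cphi cpsi Eq ba sz.
have [M0 _ uphi] := cone2_uncoupled cphi a01 cK.
have [_ _ upsi] := cone2_uncoupled cpsi a01 cK.
rewrite -Eq in upsi; set M := expectation01 phi in M0 uphi upsi *.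
have [m [g [g' [/andP[m0 mC] [cg _ gm] [cg' _ g'm] gg]]]] :=
  HC M _ _ bs M0 ba (ltnW sz) uphi upsi.
have b0 : {in bs, forall b, 0 < b} by move=> b /ba /andP[].
have min1 f x : 0 < x <= 1 -> f x = f (Num.min x 1).
  by move=> /andP[_ /min_idPl ->].
have diffE x : 0 < x <= 1 -> transfer_seq bs phi x - transfer_seq bs psi x = g x - g' x.
  move=> x01; rewrite -gg.
  by congr (_ - _); apply: transfer_seq_pm_seq => // y; exact: min1.
have sub01 : (`]0, 1]%classic : set R) `<=` `]0, +oo[.
  by apply: subset_itv; rewrite bnd_simp.
have mg := cone_measurable (measurable_itv `]0, 1]) sub01 cg.
have mg' := cone_measurable (measurable_itv `]0, 1]) sub01 cg'.
have [_ g0 _ _] := cg; have [_ g'0 _ _] := cg'.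
have : (L1norm (fun x => (transfer_seq bs phi x - transfer_seq bs psi x)%R) <= (2 * m)%:E)%E.
  have mN : measurable_fun (`]0, 1]%classic : set R) (EFin \o (fun x => `|g x - g' x|)).
    apply/measurable_EFinP; apply: measurableT_comp => //.
    by apply: measurable_funB; exact/measurable_EFinP.
  rewrite /L1norm -integral_itv_obnd_cbnd; last first.
    apply: eq_measurable_fun mN => x; rewrite inE/= in_itv/= => x01.
    by rewrite diffE.
  apply: (@le_trans _ _ (\int[mu]_(x in `]0%R, 1%R]) ((g x)%:E + (g' x)%:E))%E).
    apply: ge0_le_integral => //=.
    - apply: eq_measurable_fun mN => x; rewrite inE/= in_itv/= => x01.
      by rewrite diffE.
    - exact: emeasurable_funD.
    - move=> x; rewrite in_itv/= -EFinD lee_fin => x01; rewrite diffE//.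
      by rewrite (le_trans (ler_normB _ _))// !ger0_norm ?g0 ?g'0.
  rewrite ge0_integralD//= gm g'm -EFinD lee_fin; lra.
move/le_trans; apply; rewrite lee_fin /loss_rate.
set w := _ `^ (- a^-1 + 1) in mC *; set v := ln _ `^ _.
have sv : s <= v.
  apply: ge0_ler_powR; first by rewrite invr_ge0 ltW.
  - by rewrite nnegrE ltW.
  - by rewrite nnegrE ln_ge0// ler1n ltnW.
  - by rewrite ler_ln ?posrE ?ltr0n ?ler_nat// ltnW.
rewrite (_ : C / s * (2 * M) * (w * v) = 2 * (C * M * w) * (v / s)); last by ring.
have CMw : 0 <= C * M * w by rewrite mulr_ge0 ?powR_ge0// mulr_ge0.
apply: (@le_trans _ _ (2 * (C * M * w))); first by rewrite ler_wpM2l.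
have v1 : 1 <= v / s by rewrite ler_pdivlMr// mul1r.
by rewrite ler_peMr// (mulr_ge0 _ CMw).
Qed.

End Transfer.

(** * Moving C^1 observables into the cone *)

Section C1Observables.
Context {R : realType}.
Local Notation mu := (@lebesgue_measure R).
Implicit Types a b c d x y t : R.
Implicit Types f g phi psi : R -> R.

Lemma sup_norm_itv01_ge f x : continuous f -> x \in `[0, 1] ->
  `|f x| <= sup [set `|f x| | x in `[0, 1]].
Proof.
move=> cf x01.
have [M _ MP] : exists2 c : R, c \in `[0, 1]%R & forall y, y \in `[0, 1]%R -> `|f y| <= `|f c|.
  apply: (@EVT_max R (fun y => `|f y|)) => //.
  apply: continuous_subspaceT => y.
  by apply: continuous_comp; [exact: cf|exact: norm_continuous].
apply: ub_le_sup; last by exists x.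
by exists `|f M| => _ [y y01 <-]; exact: MP.
Qed.

Lemma C1norm_ge phi x : C1_circle phi -> x \in `[0, 1] ->
  `|phi x| <= C1norm phi /\ `|derive1 phi x| <= C1norm phi.
Proof.
move=> [_ dphi cphi'] x01.
have cphi : continuous phi.
  by move=> y; apply: differentiable_continuous; exact/derivable1_diffP.
have := sup_norm_itv01_ge cphi x01; have := sup_norm_itv01_ge cphi' x01.
have := normr_ge0 (phi x); have := normr_ge0 (derive1 phi x).
rewrite /C1norm; split; lra.
Qed.

(* For |phi|, |phi'| <= t the slope -t makes f := [tilt t phi] decreasing, and
   the constant 5t gives 3t <= f <= 6t, whence also x f' >= -f. *)
Definition tilt t phi x : R := phi x + (5 * t - t * x).

Lemma C1_cone2 a t phi : 0 < a < 1 -> C1_circle phi -> C1norm phi <= t ->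
  [/\ cone2 a 2 (tilt t phi), expectation01 (tilt t phi) <= 6 * t &
   expectation01 (tilt t phi) = expectation01 phi + expectation01 (fun x => 5 * t - t * x)].
Proof.
move=> a01 Cphi phit; have [_ dphi cphi'] := Cphi; have /andP[a0 a1] := a01.
have cphi : continuous phi.
  by move=> y; apply: differentiable_continuous; exact/derivable1_diffP.
have cw : continuous (fun x : R => 5 * t - t * x).
  move=> x; apply: cvgB; first exact: cvg_cst.
  by apply: cvgM; [exact: cvg_cst|exact: cvg_id].
have ct : continuous (tilt t phi).
  by move=> x; apply: cvgD; [exact: cphi|exact: cw].
have int f : continuous f -> mu.-integrable `[0, 1] (EFin \o f).
  move=> cf; apply: continuous_compact_integrable; first exact: segment_compact.
  exact: continuous_subspaceT.
have bphi x : 0 <= x <= 1 -> - t <= phi x <= t.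
  move=> x01; have [+ _] := @C1norm_ge phi x Cphi x01.
  by move=> h; rewrite -ler_norml (le_trans h).
have t0 : 0 <= t by have := bphi 0; rewrite lexx ler01 => /(_ isT); lra.
have lip x y : 0 <= x -> x <= y -> y <= 1 ->
    - (t * (y - x)) <= phi y - phi x <= t * (y - x).
  move=> x0 xy y1.
  have [||c cxy ->] := @MVT_segment R phi (derive1 phi) x y xy.
  - by move=> z _; rewrite derive1E; apply: DeriveDef.
  - exact: continuous_subspaceT.
  have c01 : c \in `[0, 1] by move: cxy; rewrite !in_itv/=; lra.
  have [_ h] := C1norm_ge Cphi c01.
  have {}h : `|derive1 phi c| <= t by exact: le_trans phit.
  by rewrite -ler_norml normrM (ger0_norm (_ : 0 <= y - x)) ?subr_ge0// ler_wpM2r// subr_ge0.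
have btilt x : 0 <= x <= 1 -> 3 * t <= tilt t phi x <= 6 * t.
  move=> x01; have := bphi x x01; rewrite /tilt.
  have : 0 <= t * x by rewrite mulr_ge0//; lra.
  have : t * x <= t by rewrite ler_piMr//; lra.
  lra.
have E3 : 3 * t <= expectation01 (tilt t phi).
  have -> : 3 * t = expectation01 (fun=> 3 * t).
    rewrite /expectation01 Rintegral_cst//= lebesgue_measure_itv/= lte_fin ltr01.
    by rewrite oppr0 adde0 mulr1.
  apply: le_Rintegral => //; [exact/int/cst_continuous|exact: int|].
  by move=> x; rewrite /= in_itv/= => /btilt /andP[].
have E6 : expectation01 (tilt t phi) <= 6 * t.
  have -> : 6 * t = expectation01 (fun=> 6 * t).
    rewrite /expectation01 Rintegral_cst//= lebesgue_measure_itv/= lte_fin ltr01.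
    by rewrite oppr0 adde0 mulr1.
  apply: le_Rintegral => //; [exact: int|exact/int/cst_continuous|].
  by move=> x; rewrite /= in_itv/= => /btilt /andP[].
split => //; last first.
  by rewrite /expectation01 -RintegralD//; exact: int.
split; [split|exact: int|].
- exact: continuous_subspaceT.
- move=> x; rewrite in_itv/= => /andP[x0 x1].
  by have := btilt x; rewrite (ltW x0) x1 => /(_ isT); lra.
- move=> y x; rewrite !in_itv/= => /andP[y0 y1] /andP[x0 x1] xy.
  by have := lip x y (ltW x0) xy y1; rewrite /tilt; lra.
- move=> x y; rewrite !in_itv/= => /andP[x0 x1] /andP[y0 y1] xy.
  (* As z^a increases, it suffices that x f(x) does, for f = [tilt t phi]. Its increment is (y - x)
     f(y) + x (f(y) - f(x)) >= (3t - 2t x) (y - x), the slopes of f being at least -2t. *)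
  have pw (z : R) : 0 < z -> z `^ (a + 1) = z `^ a * z.
    by move=> z0; rewrite powRD ?(gt_eqF z0) ?implybT// powRr1// ltW.
  rewrite !pw// -!mulrA.
  have tx : 0 <= x * tilt t phi x.
    by have := btilt x; rewrite (ltW x0) x1 => /(_ isT) ?; rewrite mulr_ge0 ?(ltW x0)//; lra.
  apply: ler_pM; rewrite ?powR_ge0//.
    by apply: ge0_ler_powR; rewrite ?nnegrE ?(ltW a0) ?(ltW x0) ?(ltW y0).
  have := lip x y (ltW x0) xy y1.
  have := btilt y; rewrite (ltW y0) y1 => /(_ isT) /andP[ty _] /andP[l _].
  have h1 : (y - x) * (3 * t) <= (y - x) * tilt t phi y by rewrite ler_wpM2l// subr_ge0.
  have h2 : x * - (2 * t * (y - x)) <= x * (tilt t phi y - tilt t phi x).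
    by rewrite ler_wpM2l ?(ltW x0)// /tilt; lra.
  have h3 : 0 <= (1 - x) * (2 * t * (y - x)) by rewrite !mulr_ge0// subr_ge0.
  have h4 : 0 <= t * (y - x) by rewrite mulr_ge0// subr_ge0.
  lra.
(* The cone constant 2 is the ratio of the upper bound 6t of f to the lower bound 3t of its mean. *)
- move=> x; rewrite in_itv/= => /andP[x0 x1].
  have := btilt x; rewrite (ltW x0) x1 => /(_ isT) /andP[_ h].
  have p1 : 1 <= x `^ (- a) by rewrite -(powRr0 x) ger_powR ?x0//; lra.
  apply: (le_trans h); apply: (@le_trans _ _ (2 * 1 * expectation01 (tilt t phi))); first lra.
  by rewrite ler_wpM2r ?ler_wpM2l//; lra.
Qed.

End C1Observables.

Unset Implicit Arguments.

Theorem theorem2p6 (R : realType) :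
  exists F : R -> R, affine_fun F /\
  forall alpha a : R, 0 < alpha < 1 -> 0 < a ->
  exists C : R,
    (forall phi psi : R -> R,
       cone2 alpha a phi -> cone2 alpha a psi ->
       expectation01 phi = expectation01 psi ->
       forall (n : nat) (bs : n.-tuple R), (1 < n)%N ->
       {in bs, forall b, 0 < b <= alpha} ->
       (L1norm (fun x => (transfer_seq bs phi x - transfer_seq bs psi x)%R)
        <= C%:E * (L1norm phi + L1norm psi) * (loss_rate alpha n)%:E)%E)
    /\
    (forall phi psi : R -> R,
       C1_circle phi -> C1_circle psi ->
       expectation01 phi = expectation01 psi ->
       forall (n : nat) (bs : n.-tuple R), (1 < n)%N ->
       {in bs, forall b, 0 < b <= alpha} ->
       (L1norm (fun x => (transfer_seq bs phi x - transfer_seq bs psi x)%R)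
        <= (C * F (C1norm phi + C1norm psi) * loss_rate alpha n)%:E)%E).
Proof.
exists id; split; first by exists 1, 0 => t; rewrite mul1r addr0.
move=> alpha a alpha01 a0; have /andP[al0 al1] := alpha01.
(* One K for all purposes: [a] for the given densities, 2 for the tilted observables, 3/(1 - alpha)
   for the invariance of the bound. *)
set K := Num.max (Num.max a 2) (3 / (1 - alpha)).
have aK : a <= K by rewrite !le_max lexx.
have K2 : 2 <= K by rewrite !le_max lexx orbT.
have K3 : 3 <= K * (1 - alpha).
  by rewrite -ler_pdivrMr ?subr_gt0// !le_max lexx orbT.
have [C C0 HC] := memory_loss alpha01 K3.
have l0 n : 0 <= loss_rate alpha n by rewrite mulr_ge0 ?powR_ge0.
(* 12 comes from the tilted observables: twice the bound 6t on their mass. It is more than the cone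
   densities require. *)
exists (12 * C); split.
- move=> phi psi cphi cpsi E n bs n1 ba.
  have := HC a phi psi bs aK cphi cpsi E ba; rewrite size_tuple => /(_ n1).
  move=> /le_trans; apply.
  have [M0 -> _] := cone2_uncoupled cphi alpha01 aK.
  have [_ -> _] := cone2_uncoupled cpsi alpha01 aK.
  rewrite -E -EFinD -!EFinM lee_fin ler_wpM2r//.
  have : 0 <= C * expectation01 phi by rewrite mulr_ge0.
  lra.
- move=> phi psi Cphi Cpsi E n bs n1 ba; rewrite /=.
  (* The same t for both observables, so that the same affine function is added to each:
     expectations stay equal, and by additivity it cancels in the difference of the images. *)
  set t := C1norm phi + C1norm psi.
  have z01 : (0 : R) \in `[0, 1] by rewrite in_itv/= lexx ler01.
  have phi0 : 0 <= C1norm phi.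
    by have [h _] := C1norm_ge Cphi z01; exact: le_trans (normr_ge0 _) h.
  have psi0 : 0 <= C1norm psi.
    by have [h _] := C1norm_ge Cpsi z01; exact: le_trans (normr_ge0 _) h.
  have phit : C1norm phi <= t by rewrite lerDl.
  have psit : C1norm psi <= t by rewrite lerDr.
  have [c1 E1 F1] := C1_cone2 alpha01 Cphi phit.
  have [c2 _ F2] := C1_cone2 alpha01 Cpsi psit.
  have EE : expectation01 (tilt t phi) = expectation01 (tilt t psi).
    by rewrite F1 F2 E.
  have := HC 2 _ _ bs K2 c1 c2 EE ba; rewrite size_tuple => /(_ n1).
  have -> : (fun x => transfer_seq bs (tilt t phi) x - transfer_seq bs (tilt t psi) x) =
      (fun x => transfer_seq bs phi x - transfer_seq bs psi x).
    apply/funext => x; rewrite /tilt !transfer_seqD; ring.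
  move=> /le_trans; apply; rewrite lee_fin ler_wpM2r//.
  have : C * expectation01 (tilt t phi) <= C * (6 * t) by rewrite ler_wpM2l.
  lra.
Qed.
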